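(* Let $p,r,t,u,v\in\mathbb N$ and $q,s\in\mathbb Z_+$. Then $$\frac{\log\beta(2r)}{2r}\ge h_2\ge\frac{\log\beta(p+2q)-\log\beta(2q)}{p},\qquad \frac{\log\tilde\beta(2r)}{2r}\ge\tilde h_2\ge\frac{\log\tilde\beta(p+2q)-\log\tilde\beta(2q)}{p},$$ $$\frac{\log\beta(2r,2t)}{4rt}\ge h_3\ge\frac{\log\beta(p+2q,u+2s)-\log\beta(p+2q,2s)}{up}-\frac{\log\beta(2q,2v)}{2vp},$$ $$\frac{\log\tilde\beta(2r,2t)}{4rt}\ge\tilde h_3\ge\frac{\log\tilde\beta(p+2q,u+2s)-\log\tilde\beta(p+2q,2s)}{up}-\frac{\log\tilde\beta(2q,2v)}{2vp},$$ with the conventions $\beta(0)=\tilde\beta(0)=2$ and $\beta(n,0)=\beta(0,n)=\tilde\beta(n,0)=\tilde\beta(0,n)=2^n$ for $n\in\mathbb N$.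
   Context: For $d\in\{2,3\}$: colors $\{1,\dots,2d+1\}$, $\Gamma=(\Gamma_1,\dots,\Gamma_d)$ with $(k,q)\in\Gamma_k\iff q=k+d$ and, for $j\ne k$, $(j,q)\in\Gamma_k\iff q\ne k+d$. $W(\mathbf m)$: maps $\phi:\langle\mathbf m\rangle=\prod_i\{1,\dots,m_i\}\to\{1,\dots,2d+1\}$ with $(\phi_{\mathbf i},\phi_{\mathbf i+\mathbf e_k})\in\Gamma_k$ whenever both points lie in $\langle\mathbf m\rangle$ (monomer-dimer covers of the box, dimers may protrude); $\widetilde W(\mathbf m)$ the same with colors in $\{1,\dots,2d\}$ (dimer covers). $h_d=\lim_{\mathbf m\to\infty}\log\#W(\mathbf m)/|\mathbf m|_{\mathrm{pr}}$ and $\tilde h_d=\lim_{\mathbf m\to\infty}\log\#\widetilde W(\mathbf m)/|\mathbf m|_{\mathrm{pr}}$, where $|\mathbf m|_{\mathrm{pr}}=\prod m_i$. For $\mathbf m'\in\mathbb N^{d-1}$ (so $\mathbf m'=(m_1)$ when $d=2$ and $(m_1,m_2)$ when $d=3$): the torus multigraph of $T(\mathbf m')=\prod_k\mathbb Z/m_k\mathbb Z$ (identified with $\langle\mathbf m'\rangle$) has, for each vertex $\mathbf i$ and each $k$ with $m_k\ge2$, one edge joining $\mathbf i$ and $\mathbf i+\mathbf e_k$ (mod $m_k$), so two distinct parallel edges when $m_k=2$. $B(\mathbf m')$ is the matrix indexed by pairs $(S,T)$ of subsets of $\langle\mathbf m'\rangle$, with entry $0$ if $S\cap T\ne\emptyset$,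 and otherwise the number of sets of pairwise vertex-disjoint edges of the torus multigraph with all endpoints in $U=\langle\mathbf m'\rangle\setminus(S\cup T)$; $\tilde B(\mathbf m')$ likewise but counting only edge sets covering every point of $U$ (value $1$ if $U=\emptyset$). $\beta(\mathbf m')$ and $\tilde\beta(\mathbf m')$ are the spectral radii of $B(\mathbf m')$ and $\tilde B(\mathbf m')$. *)

(* Defs.v *)
From HB Require Import structures.
From mathcomp Require Import all_boot all_order all_algebra.
From mathcomp Require Import complex.
From mathcomp Require Import all_classical all_reals all_analysis.
Set Implicit Arguments.
Unset Strict Implicit.
Unset Printing Implicit Defensive.
Import Order.TTheory GRing.Theory Num.Theory.
Import numFieldNormedType.Exports.
Local Open Scope classical_set_scope.
Local Open Scope ring_scope.

(* Coordinates, directions and colors are numbered from 0: the point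
   (i_1, .., i_n) of <m> = \prod_k {1, .., m_k} is (i_1 - 1, .., i_n - 1) here,
   the direction k is k - 1 and the color q is q - 1. *)
Definition box (n : nat) (m : n.-tuple nat) : finType :=
  {dffun forall k : 'I_n, 'I_(tnth m k)}.

(* j = i + e_k inside the box (no wrap-around) *)
Definition next_in_box (n : nat) (m : n.-tuple nat) (k : 'I_n) (i j : box m)
    : bool :=
  (j k == (i k).+1 :> nat)
  && [forall l : 'I_n, (l != k) ==> (j l == i l :> nat)].

(* (a, b) \in Gamma_k *)
Definition Gamma (d : nat) (k : 'I_d) (a b : nat) : bool :=
  if a == k then b == (k + d)%N else b != (k + d)%N.

Definition covers_with (d c : nat) (m : d.-tuple nat)
    : {set {ffun box m -> 'I_c}} :=
  [set phi : {ffun box m -> 'I_c} |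
    [forall k : 'I_d, forall i : box m, forall j : box m,
      next_in_box k i j ==> Gamma k (phi i) (phi j)]]%SET.

Definition monomer_dimer_covers (d : nat) (m : d.-tuple nat) :=
  covers_with (2 * d).+1 m.
Definition dimer_covers (d : nat) (m : d.-tuple nat) :=
  covers_with (2 * d) m.

(* m -> oo in N^d: every coordinate of m tends to infinity *)
Definition multi_infty (d : nat) : set_system (d.-tuple nat) :=
  filter_from [set: nat]
    (fun N => [set m : d.-tuple nat | forall k, (N <= tnth m k)%N]).

Global Instance multi_infty_filter (d : nat) : ProperFilter (@multi_infty d).
Proof.
apply: filter_from_proper; last first.
  by move=> N _; exists [tuple N | k < d] => k; rewrite tnth_mktuple.
apply: filter_from_filter; first by exists 0%N.
move=> M N _ _; exists (maxn M N) => // m mMN.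
by split=> k; apply: leq_trans (mMN k); rewrite (leq_maxl, leq_maxr).
Qed.

Definition prod_norm (d : nat) (m : d.-tuple nat) : nat :=
  (\prod_(k < d) tnth m k)%N.

Definition h (R : realType) (d : nat) : R :=
  lim (ln (#|monomer_dimer_covers m|%:R : R) / (prod_norm m)%:R
        @[m --> @multi_infty d]).

Definition h_tilde (R : realType) (d : nat) : R :=
  lim (ln (#|dimer_covers m|%:R : R) / (prod_norm m)%:R
        @[m --> @multi_infty d]).

(* i + e_k on the torus *)
Definition torus_next (n : nat) (m : n.-tuple nat) (k : 'I_n) (i : box m)
    : box m :=
  [ffun l : 'I_n => (if l == k then ordS (i l) else i l) : 'I_(tnth m l)].

(* The edge of the torus multigraph from i to i + e_k is represented by the pair
   (i, k), so that the two parallel edges arising when m_k = 2 are distinct;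
   pairs with m_k < 2 are not edges. *)
Definition torus_edges (n : nat) (m : n.-tuple nat) : {set box m * 'I_n} :=
  [set e : box m * 'I_n | (2 <= tnth m e.2)%N]%SET.

Definition endpoints (n : nat) (m : n.-tuple nat) (e : box m * 'I_n)
    : {set box m} :=
  [set e.1; torus_next e.2 e.1]%SET.

Definition matchings (n : nat) (m : n.-tuple nat) (U : {set box m})
    : {set {set box m * 'I_n}} :=
  [set M : {set box m * 'I_n} |
    [&& M \subset torus_edges m,
        [forall e in M, endpoints e \subset U] &
        [forall e in M, forall f in M,
          (e != f) ==> [disjoint endpoints e & endpoints f]]]]%SET.

Definition perfect_matchings (n : nat) (m : n.-tuple nat) (U : {set box m})
    : {set {set box m * 'I_n}} :=
  [set M in matchings U | \bigcup_(e in M) endpoints e == U]%SET.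

(* The rows and columns are indexed by the subsets of <m>, in the order of
   their enumeration. *)
Definition subset_matrix (R : realType) (X : finType)
    (F : {set X} -> {set X} -> R) : 'M[R]_#|{: {set X}}| :=
  \matrix_(i, j) F (enum_val i) (enum_val j).

Definition B (R : realType) (n : nat) (m : n.-tuple nat) :=
  subset_matrix (fun S T : {set box m} =>
    if [disjoint S & T] then #|matchings (~: (S :|: T))%SET|%:R else 0 : R).

Definition B_tilde (R : realType) (n : nat) (m : n.-tuple nat) :=
  subset_matrix (fun S T : {set box m} =>
    if [disjoint S & T] then #|perfect_matchings (~: (S :|: T))%SET|%:R
    else 0 : R).

Definition spectral_radius (R : realType) (n : nat) (A : 'M[R]_n) : R :=
  sup [set complex.Re `|z| | z in
    [set z : R[i] | eigenvalue (map_mx (real_complex R) A) z]].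

Definition beta (R : realType) (n : nat) (m : n.-tuple nat) : R :=
  spectral_radius (B R m).
Definition beta_tilde (R : realType) (n : nat) (m : n.-tuple nat) : R :=
  spectral_radius (B_tilde R m).

(* When an argument is 0 the values below are conventions and not spectral
   radii; the value at (0, 0) is irrelevant. *)
Definition beta1 (R : realType) (a : nat) : R :=
  if a == 0%N then 2 else beta R [tuple a].
Definition beta1_tilde (R : realType) (a : nat) : R :=
  if a == 0%N then 2 else beta_tilde R [tuple a].

Definition beta2 (R : realType) (a b : nat) : R :=
  if a == 0%N then 2 ^+ b else if b == 0%N then 2 ^+ a
  else beta R [tuple a; b].
Definition beta2_tilde (R : realType) (a b : nat) : R :=
  if a == 0%N then 2 ^+ b else if b == 0%N then 2 ^+ a
  else beta_tilde R [tuple a; b].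

(* Main.v *)
(* With N x N' tori in place of boxes, the number of covers is the trace of a
   power of the symmetric matrix B, so Z(m, n) = tr B(m)^n = tr B(n)^m, and
   likewise in dimension 3. If A is symmetric of size N and spectral radius rho,
   then rho^(2k) <= tr A^(2k), tr A^k <= N rho^k and
   tr A^(p+2q) <= rho^p tr A^(2q). Reading Z(2r, n) and Z(p+2q, n) along both
   directions gives the bounds up to O(1/n), with tr A^0 = N accounting for the
   conventions beta(0) = 2 and beta(n, 0) = 2^n.

   Boxes are compared with tori by reflection: 2^d covers of the box m which
   agree on the boundary glue, after reflections, to a cover of the torus 2m, so
   log #W(m) / |m| and log Z(2m) / |2m| differ by O(sum_k 1 / m_k). Hence the
   limit h_d exists and is the infimum of the upper bounds. *)

Require Import Defs.
From HB Require Import structures.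
From mathcomp Require Import all_boot all_order all_algebra.
From mathcomp Require Import perm complex zify ring lra.
From mathcomp Require Import all_classical all_reals all_analysis.
Set Implicit Arguments.
Unset Strict Implicit.
Unset Printing Implicit Defensive.
Import Order.TTheory GRing.Theory Num.Theory.
Import numFieldNormedType.Exports.
Local Open Scope ring_scope.

(** Edge sets are awkward to cut and glue, so [B] and [B_tilde] are rewritten as counts of colored
    layers ([layers]). A dimer becomes a pair of matching colors on neighbouring points, a condition
    that treats all directions alike, and the number of covers depends only on the sides of the
    torus. Short sides agree with the multigraph: the colors of the two ends keep the parallel edges
    of a side 2 apart, and on a side 1 a dimer would need two colors at one point. Even sizes serve
    twice: even powers make every term of a trace nonnegative, and doubling a box yields even sides.
    [lim] says nothing until convergence is known. [lim_multi_infty] settles this once, for a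
    sequence squeezed between the upper bound at [m] and the upper bound at any other [m'] plus an
    error O(sum of 1 / m_k); what remains are inequalities between spectral radii. In the lower
    bound for h_3 the torus is shortened in two directions in turn. The second step subtracts log
    beta(2q, n) / n with n large, which must be bounded from above: hence the term with 2v. *)

(** * Traces of powers of a real symmetric matrix *)

Lemma mulmx_diag_conj_exp (F : fieldType) (n : nat) (P : 'M[F]_n)
    (d : 'rV[F]_n) (k : nat) : P \in unitmx ->
  (invmx P *m diag_mx d *m P) ^+ k
    = invmx P *m diag_mx (\row_i d ord0 i ^+ k) *m P.
Proof.
move=> uP; elim: k => [|k IH].
  rewrite expr0 (_ : \row_i _ = const_mx 1); last first.
    by apply/rowP => i; rewrite !mxE expr0.
  by rewrite diag_const_mx mulmx1 mulVmx.
rewrite exprS IH; set D := diag_mx d.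
change (invmx P *m D *m P *m (invmx P *m diag_mx (\row_i d 0 i ^+ k) *m P)
  = invmx P *m diag_mx (\row_i d 0 i ^+ k.+1) *m P).
rewrite !mulmxA mulmxK // -(mulmxA (invmx P) D) /D mulmx_diag.
by congr (_ *m diag_mx _ *m _); apply/rowP => i; rewrite !mxE exprS.
Qed.

(** The complexification of [A] is Hermitian, so the spectral theorem conjugates it to a diagonal
    matrix with real entries [d]. Listing the eigenvalues with multiplicity gives the traces, and
    makes the supremum in [spectral_radius] a maximum over a finite set. *)
Lemma symmetric_eigenvalues (R : realType) (n : nat) (A : 'M[R]_n) :
    A^T = A ->
  exists d : 'I_n -> R,
    [/\ forall k, \tr (A ^+ k) = \sum_i d i ^+ k,
        forall i, `|d i| <= spectral_radius A
      & (0 < n)%N -> exists i, spectral_radius A = `|d i|].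
Proof.
move=> symA; set Ac := map_mx (real_complex R) A.
have hA : Ac \is hermsymmx.
  apply: realsym_hermsym.
    apply/is_hermitianmxP; rewrite expr0 scale1r map_mx_id //.
    by apply/matrixP => i j; rewrite !mxE -[in RHS]symA mxE.
  by apply/mxOverP => i j; rewrite mxE; apply/complex_realP; exists (A i j).
have := hermitian_spectral_diag_real hA.
have := @orthomx_spectralP _ _ Ac (hermitian_normalmx hA).
have := spectral_unit Ac.
set P := spectralmx Ac; set D := spectral_diag Ac => uP AE realD.
pose d i := complex.Re (D ord0 i).
have DE i : D ord0 i = (d i)%:C%C.
  by rewrite RRe_real //; have /mxOverP := realD; apply.
(* Eigenvectors are row vectors: [v *m invmx P] is an eigenvector of the diagonal matrix, and any
   nonzero coordinate of it identifies the eigenvalue. Conversely, row [i] of [P] is an eigenvector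
   for [d i]. *)
have eigE z : eigenvalue Ac z <-> exists i, z = (d i)%:C%C.
  split=> [/eigenvalueP[v vA v0]|[i ->]].
    pose w := v *m invmx P.
    have wD : w *m diag_mx D = z *: w.
      by rewrite /w scalemxAl -vA AE !mulmxA mulmxK.
    have w0 : w != 0.
      apply: contra_neq v0 => w0.
      by rewrite -[v]mulmx1 -(mulVmx uP) mulmxA -/w w0 mul0mx.
    have [i wi] : exists i, w ord0 i != 0.
      apply/existsP; apply: contraNT w0 => /existsPn w0.
      apply/eqP/rowP => i; rewrite [RHS]mxE; apply/eqP/negPn; exact: w0.
    exists i; have /rowP/(_ i) := wD.
    by rewrite mul_mx_diag [LHS]mxE [RHS]mxE mulrC DE => /(mulIf wi).
  apply/eigenvalueP; exists (row i P); last first.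
    apply: contraTneq uP => r0; apply/negP => uP.
    have : row i P *m invmx P = 0 by rewrite r0 mul0mx.
    rewrite -row_mul mulmxV // => /rowP/(_ i); rewrite !mxE eqxx => /eqP.
    by rewrite oner_eq0.
  rewrite AE !mulmxA -row_mul mulmxV // row1 -rowE.
  by rewrite row_diag_mx -scalemxAl -rowE DE.
have setE : [set complex.Re `|z| | z in
    [set z : R[i] | eigenvalue Ac z]]%classic
    = [set `|d i| | i in [set: 'I_n]]%classic.
  apply/seteqP; split=> x /=.
    case=> z /eigE[i ->] <-; exists i => //.
    by rewrite /Normc.normc /= expr0n addr0 sqrtr_sqr.
  case=> i _ <-; exists (d i)%:C%C; first by apply/eigE; exists i.
  by rewrite /Normc.normc /= expr0n addr0 sqrtr_sqr.
have ub : has_ubound [set `|d i| | i in [set: 'I_n]]%classic.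
  exists (\sum_i `|d i|) => x [i _ <-].
  by rewrite (bigD1 i) //= lerDl sumr_ge0.
exists d; split.
- move=> k; have trC : real_complex R (\tr (A ^+ k)) = \tr (Ac ^+ k).
    have <- : map_mx (real_complex R) (A ^+ k) = Ac ^+ k.
      exact: (rmorphXn (map_mx (real_complex R))).
    by rewrite /mxtrace rmorph_sum; apply: eq_bigr => i _; rewrite mxE.
  apply: (fmorph_inj (real_complex R)); apply: etrans trC _.
  rewrite AE mulmx_diag_conj_exp // -mulmxA mxtrace_mulC mulmxK //.
  rewrite mxtrace_diag rmorph_sum.
  by apply: eq_bigr => i _; rewrite mxE DE rmorphXn.
- move=> i; rewrite /spectral_radius -/Ac setE.
  by apply: ub_le_sup => //; exists i.
- move=> n0; rewrite /spectral_radius -/Ac setE.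
  case: (@arg_maxP _ _ _ (Ordinal n0) xpredT (fun i => `|d i|) isT).
  move=> i _ maxi; exists i; apply/le_anti/andP; split.
    apply: ge_sup; first by exists `|d i|; exists i.
    by move=> x [j _ <-]; apply: maxi.
  by apply: ub_le_sup => //; exists i.
Qed.

Lemma spectral_radius_ge0 (R : realType) (n : nat) (A : 'M[R]_n) :
  0 <= spectral_radius A.
Proof.
rewrite /spectral_radius; set E := (X in sup X).
(* [sup] is 0 by default on a set that is empty or not bounded above. *)
have [[[x Ex] ubE]|/sup_out -> //] := pselect (has_sup E).
apply: le_trans (ub_le_sup ubE Ex); case: Ex => z _ <-.
by case: z => a b /=; exact: sqrtr_ge0.
Qed.

(** The even exponent makes every term of the trace nonnegative, so the term of an eigenvalue of
    largest modulus is a lower bound. *)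
Lemma exp_spectral_radius_le_trace (R : realType) (n : nat) (A : 'M[R]_n)
    (k : nat) : A^T = A -> (0 < n)%N ->
  spectral_radius A ^+ (2 * k) <= \tr (A ^+ (2 * k)).
Proof.
move=> /symmetric_eigenvalues[d [trE _ rhoE]] /rhoE[i ->].
rewrite trE (bigD1 i) //= exprM real_normK ?num_real // -exprM lerDl.
by apply: sumr_ge0 => j _; rewrite exprM exprn_ge0 ?sqr_ge0.
Qed.

Lemma trace_le_exp_spectral_radius (R : realType) (n : nat) (A : 'M[R]_n)
    (k : nat) : A^T = A -> \tr (A ^+ k) <= n%:R * spectral_radius A ^+ k.
Proof.
move=> /symmetric_eigenvalues[d [trE le_rho _]].
rewrite trE -[n in n%:R]card_ord mulr_natl -sumr_const.
apply: ler_sum => i _; apply: le_trans (ler_norm _) _.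
by rewrite normrX lerXn2r ?nnegrE ?spectral_radius_ge0.
Qed.

(** Termwise, the [p]-th power of an eigenvalue multiplies an even, hence nonnegative, power. The
    size of the matrix does not enter, unlike in the previous bound. *)
Lemma traceD_le_exp_spectral_radius (R : realType) (n : nat) (A : 'M[R]_n)
    (p q : nat) : A^T = A ->
  \tr (A ^+ (p + 2 * q)) <= spectral_radius A ^+ p * \tr (A ^+ (2 * q)).
Proof.
move=> /symmetric_eigenvalues[d [trE le_rho _]].
rewrite !trE mulr_sumr; apply: ler_sum => i _; rewrite exprD.
apply: ler_wpM2r; first by rewrite exprM exprn_ge0 ?sqr_ge0.
apply: le_trans (ler_norm _) _.
by rewrite normrX lerXn2r ?nnegrE ?spectral_radius_ge0.
Qed.

(** * Covers of a torus as colorings, independently of the model of the torus *)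

(* Some (k, true) and Some (k, false) are the two ends of a dimer joining x to
   s k x; None is a monomer, forbidden when b is false. *)
Definition torus_covers (b : bool) (K X : finType) (s : K -> X -> X) :
    {set {ffun X -> option (K * bool)}} :=
  [set f : {ffun X -> option (K * bool)} |
    [forall x, [forall k, (f x == Some (k, true))
                            == (f (s k x) == Some (k, false))]
               && (b || (f x != None))]]%SET.

Lemma torus_coversP (b : bool) (K X : finType) (s : K -> X -> X)
    (f : {ffun X -> option (K * bool)}) :
  reflect ((forall k x,
              (f x == Some (k, true)) = (f (s k x) == Some (k, false)))
           /\ (forall x, b || (f x != None)))
          (f \in torus_covers b s).
Proof.
rewrite inE; apply: (iffP forallP) => [fP|[fP fb] x].
  by split=> [k x|x]; have /andP[/forallP/(_ _)/eqP] := fP x.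
by rewrite fb andbT; apply/forallP => k; rewrite fP.
Qed.

Lemma leq_card_torus_covers (b : bool) (K X K' X' : finType)
    (s : K -> X -> X) (s' : K' -> X' -> X') (f : X -> X') (g : K -> K') :
    bijective f -> bijective g ->
    (forall k x, f (s k x) = s' (g k) (f x)) ->
  (#|torus_covers b s'| <= #|torus_covers b s|)%N.
Proof.
move=> [f' fK f'K] [g' gK g'K] fs.
pose F (phi : {ffun X' -> option (K' * bool)}) :=
  [ffun x => omap (fun c => (g' c.1, c.2)) (phi (f x))].
have FE phi x k t : (F phi x == Some (k, t)) = (phi (f x) == Some (g k, t)).
  rewrite ffunE; case: (phi (f x)) => [[k' t']|] //=.
  by rewrite /eq_op /= !xpair_eqE /= (can2_eq g'K gK).
have F0 phi x : (F phi x == None) = (phi (f x) == None).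
  by rewrite ffunE; case: (phi (f x)).
rewrite -(@card_in_imset _ _ F).
  apply/subset_leq_card/fintype.subsetP => _ /imsetP[phi /torus_coversP[phiP
    phib] ->].
  apply/torus_coversP.
  by split=> [k x|x]; rewrite ?F0 ?phib // !FE fs phiP.
move=> phi psi _ _ /ffunP eqF; apply/ffunP => x.
have := eqF (f' x); rewrite !ffunE f'K.
case: (phi x) (psi x) => [[k t]|] [[k' t']|] //= [].
by move=> /(can_inj g'K) -> ->.
Qed.

Lemma card_torus_covers_iso (b : bool) (K X K' X' : finType)
    (s : K -> X -> X) (s' : K' -> X' -> X') (f : X -> X') (g : K -> K') :
    bijective f -> bijective g ->
    (forall k x, f (s k x) = s' (g k) (f x)) ->
  #|torus_covers b s| = #|torus_covers b s'|.
Proof.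
move=> bf bg fs; apply/eqP; rewrite eqn_leq (leq_card_torus_covers _ bf bg fs).
have [f' fK f'K] := bf; have [g' gK g'K] := bg.
have bf' : bijective f' by exists f.
have bg' : bijective g' by exists g.
rewrite (@leq_card_torus_covers _ _ _ _ _ s' s f' g') // => k x.
by rewrite -[k in LHS]g'K -[x in LHS]f'K -fs fK.
Qed.

(* X is the torus of sides m, with coordinates c. *)
Definition torus_coords (K X : finType) (s : K -> X -> X) (m : K -> nat)
    (c : X -> K -> nat) : Prop :=
  [/\ forall x k, (c x k < m k)%N,
      forall x y, c x =1 c y -> x = y,
      #|X| = (\prod_k m k)%N
    & forall k x l,
        c (s k x) l = if l == k then ((c x l).+1 %% m l)%N else c x l].

Lemma card_dffun_ord (K : finType) (m : K -> nat) :
  #|{dffun forall k : K, 'I_(m k)}| = (\prod_k m k)%N.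
Proof.
rewrite card_dep_ffun foldrE big_image /=.
by apply: eq_bigr => k _; exact: card_ord.
Qed.

(** Coordinates embed a torus into a product of the same cardinality, so every coordinate vector is
    attained and points with equal coordinates can be matched. This identifies the models used
    below: stacks over different boxes, and the folded torus. *)
Lemma card_torus_covers_coords (b : bool) (K X K' X' : finType)
    (s : K -> X -> X) (s' : K' -> X' -> X') (m : K -> nat) (m' : K' -> nat)
    (c : X -> K -> nat) (c' : X' -> K' -> nat) (g : K -> K') :
    torus_coords s m c -> torus_coords s' m' c' -> bijective g ->
    (forall k, m' (g k) = m k) ->
  #|torus_covers b s| = #|torus_covers b s'|.
Proof.
move=> [c_lt c_inj cardX cs] [c'_lt c'_inj cardX' c's'] bg mg.
have [g' gK g'K] := bg.
have cardXX' : #|X'| = #|X|.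
  rewrite cardX cardX' (reindex g); last exact: onW_bij.
  by apply: eq_bigr => k _; rewrite mg.
have lt' x k : (c' x (g k) < m k)%N by rewrite -mg.
pose F (x : X') : {dffun forall k : K, 'I_(m k)} := [ffun k => Ordinal (lt' x
  k)].
have F_inj : injective F.
  move=> x y /ffunP eqF; apply: c'_inj => k'.
  by have := congr1 val (eqF (g' k')); rewrite !ffunE /= g'K.
have F_bij : bijective F.
  by apply: inj_card_bij => //; rewrite card_dffun_ord cardXX' cardX.
have ex x : exists x', forall k, c' x' (g k) = c x k.
  have [F' _ F'K] := F_bij.
  exists (F' [ffun k => Ordinal (c_lt x k)]) => k.
  by have /ffunP/(_ k)/(congr1 val) := F'K [ffun k => Ordinal (c_lt x k)];
    rewrite !ffunE /=.
have [f fP] := fin_all_exists ex.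
apply: (@card_torus_covers_iso _ _ _ _ _ _ _ f g) => // [|k x].
  apply: inj_card_bij; last by rewrite cardXX'.
  by move=> x y eqf; apply: c_inj => k; rewrite -!fP eqf.
apply: c'_inj => k'; rewrite -[k']g'K fP cs c's' fP mg.
by rewrite (can_eq gK).
Qed.

Lemma box_torus_coords (n : nat) (m : n.-tuple nat) :
  torus_coords (@torus_next n m) (tnth m) (fun i k => i k).
Proof.
split=> [i k|i j eqij||k i l]; first exact: ltn_ord.
- by apply/ffunP => k; apply/val_inj/eqij.
- exact: card_dffun_ord.
- by rewrite ffunE; case: ifP.
Qed.

Definition stack_next (K X : finType) (s : K -> X -> X) (n : nat)
    (k : option K) (x : X * 'I_n) : X * 'I_n :=
  if k is Some k' then (s k' x.1, x.2) else (x.1, ordS x.2).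

Lemma stack_torus_coords (K X : finType) (s : K -> X -> X) (m : K -> nat)
    (c : X -> K -> nat) (n : nat) :
    torus_coords s m c ->
  torus_coords (@stack_next K X s n) (fun k => oapp m n k)
    (fun x k => oapp (c x.1) x.2 k).
Proof.
move=> [c_lt c_inj cardX cs]; split=> [x [k|]|[x i] [y j] eqc||k [x i] l] //=.
- by have /= := eqc None => /val_inj ->; congr pair; apply: c_inj => k;
  have := eqc (Some k).
- rewrite card_prod card_ord cardX (bigD1 None) //= mulnC; congr muln.
  rewrite (reindex_omap Some id) /=; last by case.
  by apply: eq_bigl => k; rewrite eqxx.
- by case: k l => [k|] [l|] //=; rewrite cs; case: ifP => //;
  rewrite eqE /= => ->.
Qed.

(** * Traces as closed walks, and covers of a stack of layers *)

(** A walk from [x] to [y] is recorded by its [k] intermediate points [t]: step [i] joins entry [i]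
    of [x :: t] to entry [i] of [rcons t y]. The default of [nth] is never reached. *)
Lemma expmx_tuple (R : comNzRingType) (n : nat) (A : 'M[R]_n) (k : nat)
    (x y : 'I_n) :
  (A ^+ k.+1) x y = \sum_(t : k.-tuple 'I_n)
    \prod_(i < k.+1) A (nth x (x :: t) i) (nth x (rcons t y) i).
Proof.
elim: k x => [|k IH] x.
  rewrite expr1 (big_pred1 [tuple]) ?big_ord1 // => t.
  by rewrite [t]tuple0; apply/esym/eqP.
have -> : (A ^+ k.+2) x y = \sum_z A x z * (A ^+ k.+1) z y.
  by rewrite exprS [LHS]mxE.
under eq_bigr do rewrite IH mulr_sumr.
rewrite pair_bigA /= (reindex (fun t : k.+1.-tuple 'I_n => (thead t,
  behead_tuple t))) /=.
  apply: eq_bigr => t _; rewrite [t]tuple_eta /= theadE [in RHS]big_ord_recl /=.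
  congr (_ * _); apply: eq_bigr => i _ /=.
  congr (A _ _); apply: set_nth_default => /=.
    by rewrite size_behead size_tuple.
  by rewrite size_rcons size_behead size_tuple.
exists (fun p : 'I_n * k.-tuple 'I_n => [tuple of p.1 :: p.2]) => [t _|[z t] _]
  /=.
  by rewrite -tuple_eta.
by congr pair => //; apply/val_inj.
Qed.

Lemma trace_exp_cycles (R : comNzRingType) (n : nat) (A : 'M[R]_n) (k : nat) :
  \tr (A ^+ k.+1) = \sum_(f : {ffun 'I_k.+1 -> 'I_n})
    \prod_(i < k.+1) A (f i) (f (ordS i)).
Proof.
rewrite /mxtrace; under eq_bigr do rewrite expmx_tuple.
rewrite pair_bigA /=.
pose h (f : {ffun 'I_k.+1 -> 'I_n}) :=
  (f ord0, [tuple f (lift ord0 i) | i < k]).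
rewrite (reindex h) /=.
  apply: eq_bigr => f _; apply: eq_bigr => i _.
  have fE (j : 'I_k.+1) :
      nth (f ord0) (f ord0 :: [tuple f (lift ord0 i) | i < k]) j = f j.
    case: (unliftP ord0 j) => [j' ->|-> //].
    rewrite lift0 -[LHS]/(nth (f ord0) [tuple f (lift ord0 i) | i < k] j').
    by rewrite -tnth_nth tnth_mktuple.
  rewrite fE; congr (A _ _); rewrite nth_rcons size_tuple card_ord.
  have := leq_ord i; case: ltngtP => // ik _.
    rewrite -[LHS]/(nth (f ord0) (f ord0 :: [tuple f (lift ord0 i) | i < k])
      i.+1).
    have -> : i.+1 = ordS i by rewrite /= modn_small.
    exact: fE.
  (* The closing step of the walk: [i] is [k], and [ordS i] wraps around to 0. *)
  by congr (f _); apply/val_inj; rewrite /= ik modnn.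
exists (fun p : 'I_n * k.-tuple 'I_n =>
          [ffun i => if unlift ord0 i is Some j then tnth p.2 j else p.1]).
  move=> f _; apply/ffunP => i; rewrite ffunE /=.
  by case: unliftP => [j ->|->] //; rewrite tnth_mktuple.
move=> [x t] _; rewrite /h /= ffunE unlift_none; congr pair.
by apply: eq_from_tnth => i; rewrite tnth_mktuple ffunE liftK.
Qed.

Definition vertical_ends (K X : finType) (o : bool)
    (f : {ffun X -> option (option K * bool)}) : {set X} :=
  [set x | f x == Some (None, o)]%SET.

(* A layer of a stack, whose vertical direction is None: S (resp. T) is the set
   of points matched with the layer below (resp. above). *)
Definition layers (b : bool) (K X : finType) (s : K -> X -> X) (S T : {set X}) :
    {set {ffun X -> option (option K * bool)}} :=
  [set f : {ffun X -> option (option K * bool)} |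
    [forall x, [forall k, (f x == Some (Some k, true))
                            == (f (s k x) == Some (Some k, false))]
               && (b || (f x != None))]
    && (vertical_ends false f == S) && (vertical_ends true f == T)]%SET.

Lemma layersP (b : bool) (K X : finType) (s : K -> X -> X) (S T : {set X})
    (f : {ffun X -> option (option K * bool)}) :
  reflect [/\ forall k x, (f x == Some (Some k, true))
                            = (f (s k x) == Some (Some k, false)),
              forall x, b || (f x != None),
              forall x, (f x == Some (None, false)) = (x \in S)
            & forall x, (f x == Some (None, true)) = (x \in T)]
          (f \in layers b s S T).
Proof.
rewrite inE -andbA; apply: (iffP and3P).
  case=> /forallP fP /eqP <- /eqP <-; split=> [k x|x|x|x].
  - by have /andP[/forallP/(_ k)/eqP] := fP x.
  - by have /andP[] := fP x.
  - by rewrite inE.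
  - by rewrite inE.
case=> fP fb fS fT; split.
- by apply/forallP => x; rewrite fb andbT; apply/forallP => k; rewrite fP.
- by apply/eqP/setP => x; rewrite inE fS.
- by apply/eqP/setP => x; rewrite inE fT.
Qed.

(** In a closed walk, [f i] is the set of points of layer [i] matched with the layer below, so the
    set matched upwards from layer [i] must be [f (ordS i)]. The product over a walk counts families
    of layers that fit together, and such families are exactly the covers of the cyclic stack. *)
Lemma trace_layer_matrix_exp (R : realType) (b : bool) (K X : finType)
    (s : K -> X -> X) (n : nat) :
  \tr (subset_matrix (fun S T => #|layers b s S T|%:R : R) ^+ n.+1)
    = #|torus_covers b (@stack_next K X s n.+1)|%:R.
Proof.
rewrite trace_exp_cycles.
pose L (f : {ffun 'I_n.+1 -> 'I_#|{: {set X}}|}) (i : 'I_n.+1) :=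
  layers b s (enum_val (f i)) (enum_val (f (ordS i))).
transitivity ((\sum_f #|family (L f)|)%N%:R : R).
  rewrite natr_sum; apply: eq_bigr => f _.
  rewrite card_family foldrE big_image /= natr_prod.
  by apply: eq_bigr => i _; rewrite mxE.
congr (_%:R).
pose level (psi : {ffun X * 'I_n.+1 -> option (option K * bool)}) :=
  [ffun i => [ffun x => psi (x, i)]].
pose code psi := [ffun i => enum_rank (vertical_ends false (level psi i))].
rewrite -sum1_card (partition_big code xpredT) //=.
apply: eq_bigr => f _; rewrite -sum1_card (reindex level) /=; last first.
  exists (fun phi : {ffun 'I_n.+1 -> {ffun X -> option (option K * bool)}} =>
            [ffun x => phi x.2 x.1]) => [psi _|phi _].
    by apply/ffunP => -[x i]; rewrite !ffunE.
  by apply/ffunP => i; apply/ffunP => x; rewrite !ffunE.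
apply: eq_bigl => psi; apply/familyP/andP.
  move=> psiL; split.
    apply/torus_coversP; split=> [[k|] [x i]|[x i]] /=.
    - by have /layersP[/(_ k x)] := psiL i; rewrite !ffunE.
    - have /layersP[_ _ _ /(_ x)] := psiL i; rewrite !ffunE => ->.
      by have /layersP[_ _ /(_ x)] := psiL (ordS i); rewrite !ffunE => ->.
    - by have /layersP[_ /(_ x)] := psiL i; rewrite !ffunE.
  apply/eqP/ffunP => i; rewrite ffunE -[RHS]enum_valK; congr enum_rank.
  by apply/setP => x; rewrite inE; have /layersP[_ _ ->] := psiL i.
move=> [/torus_coversP[psiP psib] /eqP <-] i; apply/layersP.
split=> [k x|x|x|x].
- by rewrite !ffunE (psiP (Some k)).
- by rewrite !ffunE.
- by rewrite [in RHS]ffunE enum_rankK inE.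
- by rewrite [in RHS]ffunE enum_rankK inE !ffunE (psiP None).
Qed.

(** * Layers correspond to matchings of the torus multigraph *)

Lemma torus_next_inj (n : nat) (m : n.-tuple nat) (k : 'I_n) :
  injective (@torus_next n m k).
Proof.
move=> i j /ffunP eqij; apply/ffunP => l; have := eqij l.
by rewrite !ffunE; case: ifP => // _; apply: (can_inj (@ordSK _)).
Qed.

(** This reconciles two treatments of sides 1: [torus_edges] excludes them, while for colorings a
    dimer with both ends at one point is contradictory. *)
Lemma torus_next_id (n : nat) (m : n.-tuple nat) (k : 'I_n) (i : box m) :
  (torus_next k i == i) = (tnth m k < 2)%N.
Proof.
apply/eqP/idP => [/ffunP/(_ k)|mk].
  rewrite ffunE eqxx => /(congr1 val) /=.
  case: (tnth m k) (i k) => [|[|p]] [j jp] //=.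
  move: jp; rewrite ltnS leq_eqVlt => /predU1P[->|jp].
    by rewrite modnn.
  by rewrite modn_small // => /eqP; rewrite eqn_leq ltnn.
apply/ffunP => l; rewrite ffunE; case: eqP => // ->; apply/val_inj => /=.
case: (tnth m k) mk (i k) => [|[|//]] _ [j jp] //=.
by rewrite modn1; case: j jp.
Qed.

Lemma matchingsP (n : nat) (m : n.-tuple nat) (U : {set box m})
    (M : {set box m * 'I_n}) :
  reflect [/\ forall i k, (i, k) \in M -> (2 <= tnth m k)%N,
              forall i k, (i, k) \in M -> i \in U /\ torus_next k i \in U
            & forall x e f, e \in M -> f \in M ->
                x \in endpoints e -> x \in endpoints f -> e = f]
          (M \in matchings U).
Proof.
rewrite inE; apply: (iffP and3P).
  case=> /fintype.subsetP ME /forall_inP MU /forall_inP Mdisj; split.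
  - by move=> i k /ME; rewrite inE.
  - move=> i k /MU /fintype.subsetP sub.
    by split; apply: sub; rewrite !inE eqxx ?orbT.
  - move=> x e f eM fM xe xf; apply/eqP; apply: contraT => nef.
    have /forall_inP/(_ f fM) := Mdisj e eM; rewrite nef /= => /pred0P/(_ x) /=.
    by rewrite xe xf.
case=> ME MU Mdisj; split.
- by apply/fintype.subsetP => -[i k] /ME; rewrite inE.
- apply/forall_inP => -[i k] /MU[iU jU]; apply/fintype.subsetP => x.
  by rewrite !inE => /orP[]/eqP ->.
- apply/forall_inP => e eM; apply/forall_inP => f fM.
  apply/implyP => nef; apply/pred0P => x /=; apply/negP => /andP[xe xf].
  by case/eqP: nef; apply: Mdisj eM fM xe xf.
Qed.

Definition layer_edges (n : nat) (m : n.-tuple nat)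
    (f : {ffun box m -> option (option 'I_n * bool)}) : {set box m * 'I_n} :=
  [set e | f e.1 == Some (Some e.2, true)]%SET.

(** Only the starting points of horizontal dimers are recorded. Their other ends follow because
    [torus_next] is bijective, the vertical ends are [S] and [T], and all remaining points are
    monomers. *)
Lemma layer_edges_inj (n : nat) (m : n.-tuple nat) (S T : {set box m}) :
  {in layers true (@torus_next n m) S T &, injective (@layer_edges n m)}.
Proof.
move=> f g /layersP[fP _ fS fT] /layersP[gP _ gS gT] /setP eqE.
have fgt x k : (f x == Some (Some k, true)) = (g x == Some (Some k, true)).
  by have := eqE (x, k); rewrite !inE.
have fgf x k : (f x == Some (Some k, false)) = (g x == Some (Some k, false)).
  have [p _ pK] := injF_bij (@torus_next_inj n m k).
  by rewrite -[x]pK -fP -gP fgt.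
have fg x c : (f x == Some c) = (g x == Some c).
  by case: c => -[k|] []; rewrite ?fgt ?fgf ?fS ?gS ?fT ?gT.
apply/ffunP => x; case Ef: (f x) => [c|].
  by apply/esym/eqP; rewrite -fg Ef.
by case Eg: (g x) => [c|] //; have := fg x c; rewrite Ef Eg eqxx.
Qed.

Lemma layer_edges_disjoint (n : nat) (m : n.-tuple nat) (S T : {set box m})
    (f : {ffun box m -> option (option 'I_n * bool)}) :
  f \in layers true (@torus_next n m) S T -> [disjoint S & T].
Proof.
case/layersP => _ _ fS fT; apply/pred0P => x /=; apply/negP.
by rewrite -fS -fT => /andP[/eqP ->].
Qed.

Lemma layer_edges_imset (n : nat) (m : n.-tuple nat) (S T : {set box m}) :
    [disjoint S & T] ->
  (@layer_edges n m @: layers true (@torus_next n m) S T)%SET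
    = matchings (~: (S :|: T)).
Proof.
move=> dST; apply/setP => M; apply/imsetP/matchingsP.
  case=> f /layersP[fP _ fS fT] ->{M}.
  have fU x k o : f x == Some (Some k, o) -> x \in (~: (S :|: T))%SET.
    by rewrite !inE -fS -fT => /eqP ->.
  split=> [i k|i k|x [i k] [j l]]; rewrite !inE /=.
  - move=> fik; rewrite leqNgt -(torus_next_id k i); apply/negP => /eqP ik.
    by have := fP k i; rewrite ik fik => /esym/eqP; rewrite (eqP fik).
  - move=> fik; have := fik; rewrite fP => fjk.
    by have := fU _ _ _ fik; have := fU _ _ _ fjk; rewrite !inE.
  - move=> fik fjl; have := fik; have := fjl; rewrite !fP => fjl' fik'.
    move=> /orP[]/eqP-> /orP[]/eqP eqx.
    + by move: fjl; rewrite -eqx (eqP fik) => /eqP[->].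
    + by move: fjl'; rewrite -eqx (eqP fik) => /eqP.
    + by move: fik'; rewrite eqx (eqP fjl) => /eqP.
    + move: fjl'; rewrite -eqx (eqP fik') => /eqP[kl].
      by move: eqx; rewrite kl => /torus_next_inj ->.
case=> ME MU Mdisj.
(* [Q x c] means that the matching, with [S] and [T], forces color [c] at [x]. Disjointness makes
   [c] unique; a point with no forced color gets [None], a monomer. *)
pose Q (x : box m) (c : option 'I_n * bool) := match c with
  | (Some k, true) => (x, k) \in M
  | (Some k, false) => [exists y, (torus_next k y == x) && ((y, k) \in M)]
  | (None, false) => x \in S
  | (None, true) => x \in T end.
have Qedge x k o : Q x (Some k, o) -> exists i,
    [/\ (i, k) \in M, x \in endpoints (i, k) & x = if o then i else torus_next
      k i].
  case: o => /= [xM|/existsP[y /andP[/eqP <- yM]]].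
    by exists x; rewrite !inE eqxx.
  by exists y; rewrite !inE eqxx orbT.
have QU x k o : Q x (Some k, o) -> x \notin (S :|: T)%SET.
  case/Qedge => i [/MU[]] + + _ ->.
  by case: o; rewrite !inE.
have dST' x : x \in S -> x \in T -> False.
  by move=> xS xT; have := pred0P dST x; rewrite /= xS xT.
have Quniq x c c' : Q x c -> Q x c' -> c = c'.
  case: c c' => [[k|] o] [[l|] o'].
  - move=> /Qedge[i [iM xi xE]] /Qedge[j [jM xj xE']].
    have [ij kl] := Mdisj _ _ _ iM jM xi xj.
    move: xE xE'; rewrite ij kl => ->.
    (* Both colors come from the same edge; if they differed, its two ends would coincide, which a
       side of length at least 2 prevents. *)
    have := ME _ _ jM; rewrite leqNgt -(torus_next_id l j).
    by case: o o' => [] [] // /eqP nj eqj; case: nj.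
  - move=> /QU; rewrite inE => /norP[xS xT].
    by case: o' => /=; [rewrite (negPf xT)|rewrite (negPf xS)].
  - move=> + /QU; rewrite inE => + /norP[xS xT].
    by case: o => /=; [rewrite (negPf xT)|rewrite (negPf xS)].
  - by case: o o' => [] [] //= x1 x2;
    [case: (dST' x x2 x1)|case: (dST' x x1 x2)].
pose f := [ffun x => [pick c | Q x c]].
have fE x c : (f x == Some c) = Q x c.
  rewrite ffunE; case: pickP => [c' Qc'|->//].
  by apply/eqP/idP => [[<-] //|Qc]; rewrite (Quniq _ _ _ Qc Qc').
exists f; last by apply/setP => -[x k]; rewrite inE fE.
apply/layersP; split=> [k x|x|x|x] //; rewrite !fE //=.
apply/idP/existsP => [xM|[y /andP[/eqP/torus_next_inj ->]] //].
by exists x; rewrite eqxx.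
Qed.

(** A point outside [S] and [T] missed by the horizontal dimers is precisely a monomer. *)
Lemma layer_edges_cover (n : nat) (m : n.-tuple nat) (S T : {set box m})
    (f : {ffun box m -> option (option 'I_n * bool)}) :
    f \in layers true (@torus_next n m) S T ->
  (\bigcup_(e in layer_edges f) endpoints e == ~: (S :|: T))%SET
    = [forall x, f x != None].
Proof.
move=> fL; have /layersP[fP _ fS fT] := fL.
have bigE x : (x \in \bigcup_(e in layer_edges f) endpoints e)%SET
    = if f x is Some (Some _, _) then true else false.
  apply/bigcupP/idP => [[[i k]]|].
    rewrite !inE /= => fik; have := fik; rewrite fP => fjk.
    by move=> /orP[]/eqP->; rewrite ?(eqP fik) ?(eqP fjk).
  case Ef: (f x) => [[[k|] o]|] // _; case: o Ef => Ef.
    by exists (x, k); rewrite !inE ?Ef eqxx.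
  have [p _ pK] := injF_bij (@torus_next_inj n m k).
  by exists (p x, k); rewrite !inE /= ?pK ?eqxx ?orbT // fP pK Ef.
apply/eqP/forallP => [/setP eqU x|fN].
  have := eqU x; rewrite bigE !inE -fS -fT.
  by case: (f x) => [[[k|] []]|].
apply/setP => x; rewrite bigE !inE -fS -fT; have := fN x.
by case: (f x) => [[[k|] []]|].
Qed.

Lemma layers_tilde (K X : finType) (s : K -> X -> X) (S T : {set X}) :
  layers false s S T
    = [set f in layers true s S T | [forall x, f x != None]]%SET.
Proof.
apply/setP => f; rewrite [RHS]inE; apply/layersP/andP.
  by case=> fP fN fS fT; split; [apply/layersP|apply/forallP].
by case=> /layersP[fP _ fS fT] /forallP.
Qed.

Lemma B_layers (R : realType) (n : nat) (m : n.-tuple nat) :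
  B R m = subset_matrix (fun S T => #|layers true (@torus_next n m) S T|%:R).
Proof.
congr subset_matrix; apply/funext => S; apply/funext => T; case: ifPn => dST.
  by rewrite -layer_edges_imset // card_in_imset //; apply: layer_edges_inj.
apply/esym/eqP; rewrite pnatr_eq0; apply/eqP/eq_card0 => f.
by apply/negP => /layer_edges_disjoint; rewrite (negPf dST).
Qed.

Lemma B_tilde_layers (R : realType) (n : nat) (m : n.-tuple nat) :
  B_tilde R m
    = subset_matrix (fun S T => #|layers false (@torus_next n m) S T|%:R).
Proof.
congr subset_matrix; apply/funext => S; apply/funext => T; rewrite layers_tilde.
case: ifPn => dST.
  rewrite -(@card_in_imset _ _ (@layer_edges n m)); last first.
    by move=> f g /setIdP[fL _] /setIdP[gL _]; apply: layer_edges_inj fL gL.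
  congr (_%:R); apply: eq_card => M; rewrite inE -layer_edges_imset //.
  apply/andP/imsetP => [[/imsetP[f fL ->]]|[f /setIdP[fL fN] ->]].
    by rewrite layer_edges_cover // => fN; exists f => //; rewrite inE fL.
  by rewrite imset_f // layer_edges_cover.
apply/esym/eqP; rewrite pnatr_eq0; apply/eqP/eq_card0 => f.
apply/negP; rewrite inE => /andP[/layer_edges_disjoint].
by rewrite (negPf dST).
Qed.

(** * Spectral radii against numbers of covers of a stack *)

Definition layer_matrix (R : realType) (b : bool) (n : nat) (m : n.-tuple nat) :
    'M[R]_#|{: {set box m}}| :=
  subset_matrix (fun S T => #|layers b (@torus_next n m) S T|%:R).

Definition stack_covers (b : bool) (n : nat) (m : n.-tuple nat) (k : nat) :=
  torus_covers b (@stack_next _ _ (@torus_next n m) k).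

Definition ln_beta (R : realType) (b : bool) (n : nat) (m : n.-tuple nat) : R :=
  ln (spectral_radius (layer_matrix R b m)).

Lemma ln_betaE (R : realType) (b : bool) (n : nat) (m : n.-tuple nat) :
  ln (if b then beta R m else beta_tilde R m) = ln_beta R b m.
Proof. by case: b; rewrite /beta ?B_layers /beta_tilde ?B_tilde_layers. Qed.

Lemma layer_matrix_sym (R : realType) (b : bool) (n : nat) (m : n.-tuple nat) :
  (layer_matrix R b m)^T = layer_matrix R b m.
Proof.
case: b; rewrite /layer_matrix -?B_layers -?B_tilde_layers;
  by apply/matrixP => i j; rewrite !mxE disjoint_sym finset.setUC.
Qed.

Lemma card_set_box (n : nat) (m : n.-tuple nat) :
  #|{: {set box m}}| = (2 ^ prod_norm m)%N.
Proof. by rewrite -cardsT -powersetT card_powerset cardsT card_dffun_ord. Qed.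

(** Each diagonal entry of the square is at least 1: the walk from [S] to its complement and back
    uses layers in which every point is a vertical end, available for dimers as well. It follows
    that the spectral radius is at least 1, so all logarithms below are nonnegative. *)
Lemma card_set_le_trace_sqr (R : realType) (b : bool) (n : nat)
    (m : n.-tuple nat) :
  #|{: {set box m}}|%:R <= \tr (layer_matrix R b m ^+ 2).
Proof.
rewrite -[X in X%:R]card_ord -sumr_const; apply: ler_sum => i _.
rewrite expr2 mxE; pose S : {set box m} := enum_val i.
rewrite (bigD1 (enum_rank (~: S)%SET)) //= -[X in X <= _]addr0.
have A_ge0 j k : 0 <= layer_matrix R b m j k by rewrite mxE.
apply: lerD; last by apply: sumr_ge0 => j _; rewrite mulr_ge0.
rewrite [X in _ * X](_ : _ = layer_matrix R b m i (enum_rank (~: S)%SET)).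
  rewrite -expr2 exprn_ege1 //.
  rewrite mxE enum_rankK -/S ler1n; apply/card_gt0P.
  exists [ffun x => Some (None, x \notin S)]; apply/layersP.
  split=> [k x|x|x|x]; rewrite !ffunE ?orbT //.
    by rewrite /eq_op /= /eq_op /=; case: (x \in S).
  by rewrite inE /eq_op /= /eq_op /=; case: (x \in S).
by rewrite -[in LHS]layer_matrix_sym mxE.
Qed.

Lemma spectral_radius_layer_ge1 (R : realType) (b : bool) (n : nat)
    (m : n.-tuple nat) : 1 <= spectral_radius (layer_matrix R b m).
Proof.
have N0 : 0 < #|{: {set box m}}|%:R :> R by rewrite card_set_box ltr0n expn_gt0.
have := trace_le_exp_spectral_radius 2 (layer_matrix_sym R b m).
move=> /(le_trans (card_set_le_trace_sqr R b m)).
by rewrite ler_pMr // expr_ge1 ?spectral_radius_ge0.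
Qed.

Lemma ln_beta_ge0 (R : realType) (b : bool) (n : nat) (m : n.-tuple nat) :
  0 <= ln_beta R b m.
Proof. by rewrite ln_ge0 // spectral_radius_layer_ge1. Qed.

(** Height 0 is a genuine exception: the empty stack has one cover, whereas the zeroth power has
    trace [2 ^ prod_norm m]. This is why q = 0 is a separate case below. *)
Lemma trace_layer_matrix (R : realType) (b : bool) (n : nat) (m : n.-tuple nat)
    (k : nat) : (0 < k)%N ->
  \tr (layer_matrix R b m ^+ k) = #|stack_covers b m k|%:R.
Proof. by case: k => // k _; rewrite trace_layer_matrix_exp. Qed.

Lemma exp_spectral_radius_le_stack_covers (R : realType) (b : bool) (n : nat)
    (m : n.-tuple nat) (k : nat) : (0 < k)%N ->
  spectral_radius (layer_matrix R b m) ^+ (2 * k)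
    <= #|stack_covers b m (2 * k)|%:R.
Proof.
move=> k0; rewrite -(@trace_layer_matrix R) ?muln_gt0 //.
apply: exp_spectral_radius_le_trace; first exact: layer_matrix_sym.
by rewrite card_set_box expn_gt0.
Qed.

Lemma stack_covers_gt0 (R : realType) (b : bool) (n : nat) (m : n.-tuple nat)
    (k : nat) : (0 < k)%N -> 0 < #|stack_covers b m (2 * k)|%:R :> R.
Proof.
move=> k0; apply: lt_le_trans (exp_spectral_radius_le_stack_covers R b m k0).
by rewrite exprn_gt0 // (lt_le_trans _ (spectral_radius_layer_ge1 R b m)).
Qed.

Lemma ln_stack_covers_ge (R : realType) (b : bool) (n : nat) (m : n.-tuple nat)
    (k : nat) : (0 < k)%N ->
  (2 * k)%:R * ln_beta R b m <= ln #|stack_covers b m (2 * k)|%:R.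
Proof.
move=> k0; have rho1 := spectral_radius_layer_ge1 R b m.
have rho0 : 0 < spectral_radius (layer_matrix R b m) by apply: lt_le_trans rho1.
rewrite mulr_natl -lnXn // ler_ln ?posrE ?exprn_gt0 //.
  exact: exp_spectral_radius_le_stack_covers.
exact: stack_covers_gt0.
Qed.

Lemma ln_stack_covers_le (R : realType) (b : bool) (n : nat) (m : n.-tuple nat)
    (k : nat) : (0 < k)%N ->
  ln #|stack_covers b m k|%:R <= (prod_norm m)%:R * ln 2 + k%:R * ln_beta R b m.
Proof.
move=> k0; have rho1 := spectral_radius_layer_ge1 R b m.
have rho0 : 0 < spectral_radius (layer_matrix R b m) by apply: lt_le_trans rho1.
have := trace_le_exp_spectral_radius k (layer_matrix_sym R b m).
rewrite trace_layer_matrix // [X in X%:R * _]card_set_box natrX => tr_le.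
(* There may be no cover, for instance by dimers when the number of points is odd; then [ln 0 = 0]
   and the right side is nonnegative. *)
have [->|Z0] := posnP #|stack_covers b m k|.
  rewrite ln0 // addr_ge0 // mulr_ge0 ?ln_beta_ge0 //.
  by rewrite ln_ge0 // ler1n.
rewrite !mulr_natl -!lnXn // -lnM ?posrE ?exprn_gt0 //.
by rewrite ler_ln ?posrE ?ltr0n ?mulr_gt0 ?exprn_gt0.
Qed.

Lemma ln_stack_coversD_le (R : realType) (b : bool) (n : nat)
    (m : n.-tuple nat) (p q : nat) : (0 < p)%N ->
  ln #|stack_covers b m (p + 2 * q)|%:R <= p%:R * ln_beta R b m
    + if q == 0%N then (prod_norm m)%:R * ln 2
      else ln #|stack_covers b m (2 * q)|%:R.
Proof.
move=> p0; case: posnP => [->|q0].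
  by rewrite muln0 addn0 addrC ln_stack_covers_le.
have rho1 := spectral_radius_layer_ge1 R b m.
have rho0 : 0 < spectral_radius (layer_matrix R b m) by apply: lt_le_trans rho1.
have := traceD_le_exp_spectral_radius p q (layer_matrix_sym R b m).
have qq0 : (0 < 2 * q)%N by rewrite muln_gt0.
rewrite !trace_layer_matrix ?ltn_addr // => tr_le.
have ln_q : 0 <= ln (#|stack_covers b m (2 * q)|%:R : R).
  apply: le_trans (ln_stack_covers_ge R b m q0).
  by rewrite mulr_ge0 ?ln_beta_ge0.
have [->|Z0] := posnP #|stack_covers b m (p + 2 * q)|.
  by rewrite ln0 // addr_ge0 // mulr_ge0 ?ln_beta_ge0.
have Zq0 : (0 < #|stack_covers b m (2 * q)|%:R :> R).
  rewrite ltr0n lt0n; apply: contraTneq tr_le => ->.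
  by rewrite mulr0 -ltNge ltr0n.
rewrite mulr_natl -lnXn // -lnM ?posrE ?exprn_gt0 //.
by rewrite ler_ln ?posrE ?ltr0n ?mulr_gt0 ?exprn_gt0.
Qed.

(* The same torus cut along two different directions. *)
Lemma ln_beta_cut_le (R : realType) (b : bool) (n n' : nat) (m : n.-tuple nat)
    (m' : n'.-tuple nat) (r k : nat) : (0 < r)%N -> (0 < k)%N ->
    #|stack_covers b m (2 * r)| = #|stack_covers b m' k| ->
  (2 * r)%:R * ln_beta R b m
    <= (prod_norm m')%:R * ln 2 + k%:R * ln_beta R b m'.
Proof.
move=> r0 k0 eqZ; apply: le_trans (ln_stack_covers_ge R b m r0) _.
by rewrite eqZ ln_stack_covers_le.
Qed.

(** The stacks over [m] of heights [p + 2 * q] and [2 * q] are recut with the even side [2 * k] as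
    height, over [m1] and [m2] respectively. Evenness of this side allows the lower bound by the
    spectral radius over [m1]. *)
Lemma ln_beta_cutD_le (R : realType) (b : bool) (n n1 n2 : nat)
    (m : n.-tuple nat) (m1 : n1.-tuple nat) (m2 : n2.-tuple nat)
    (p q k : nat) : (0 < p)%N -> (0 < k)%N ->
    #|stack_covers b m (p + 2 * q)| = #|stack_covers b m1 (2 * k)| ->
    #|stack_covers b m (2 * q)| = #|stack_covers b m2 (2 * k)| ->
  (2 * k)%:R * ln_beta R b m1 <= p%:R * ln_beta R b m
    + if q == 0%N then (prod_norm m)%:R * ln 2
      else (prod_norm m2)%:R * ln 2 + (2 * k)%:R * ln_beta R b m2.
Proof.
move=> p0 k0 eqZ1 eqZ2; apply: le_trans (ln_stack_covers_ge R b m1 k0) _.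
rewrite -eqZ1; apply: le_trans (ln_stack_coversD_le R b m q p0) _.
rewrite lerD2l; case: ifP => // _.
by rewrite eqZ2 ln_stack_covers_le // muln_gt0.
Qed.

Lemma stack_covers_swap (b : bool) (n : nat) (m m' : n.-tuple nat) (k k' : nat)
    (i : 'I_n) :
    tnth m i = k' -> tnth m' i = k ->
    (forall j, j != i -> tnth m j = tnth m' j) ->
  #|stack_covers b m k| = #|stack_covers b m' k'|.
Proof.
move=> mi m'i mj.
have cm := stack_torus_coords k (box_torus_coords m).
have cm' := stack_torus_coords k' (box_torus_coords m').
apply: card_torus_covers_coords cm cm' (inv_bij (tpermK None (Some i))) _.
move=> [j|]; last by rewrite tpermL.
have [->|ji] := eqVneq j i; first by rewrite tpermR.
by rewrite tpermD //= ?mj // eq_sym.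
Qed.

Lemma stack_covers1_swap (b : bool) (a k : nat) :
  #|stack_covers b [tuple a] k| = #|stack_covers b [tuple k] a|.
Proof. by apply: (@stack_covers_swap _ _ _ _ _ _ ord0) => // j;
  rewrite ord1. Qed.

Lemma stack_covers2_swapl (b : bool) (a c k : nat) :
  #|stack_covers b [tuple a; c] k| = #|stack_covers b [tuple k; c] a|.
Proof.
apply: (@stack_covers_swap _ _ _ _ _ _ ord0) => // j.
by case: (unliftP ord0 j) => [j' ->|->] //; rewrite ord1.
Qed.

Lemma stack_covers2_swapr (b : bool) (a c k : nat) :
  #|stack_covers b [tuple a; c] k| = #|stack_covers b [tuple a; k] c|.
Proof.
apply: (@stack_covers_swap _ _ _ _ _ _ ord_max) => // j.
by case: (unliftP ord_max j) => [j' ->|->] //; rewrite ord1.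
Qed.

(** * The numbered colors of boxes as dimer ends *)

(** Numbered from 0, color k starts a dimer in direction k, color k + d ends it, and 2d is the
    monomer. *)
Definition color_of (d a : nat) : option ('I_d * bool) :=
  if insub a is Some k then Some (k, true)
  else if insub (a - d)%N is Some k then Some (k, false) else None.

Definition color_index (d : nat) (c : option ('I_d * bool)) : nat :=
  match c with
  | Some (k, true) => k
  | Some (k, false) => (k + d)%N
  | None => (2 * d)%N
  end.

Lemma color_indexK (d : nat) : cancel (@color_index d) (@color_of d).
Proof.
rewrite /color_of; case=> [[k []]|] /=.
- by rewrite valK.
- by rewrite insubF ?addnK ?valK // ltnNge leq_addl.
- by rewrite !insubF //; apply/negbTE; rewrite -leqNgt; lia.
Qed.

Lemma color_ofK (d a : nat) : (a <= 2 * d)%N -> color_index (color_of d a) = a.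
Proof.
move=> ad; rewrite /color_of; case: insubP => [k _ <-|] //.
rewrite -leqNgt => da; case: insubP => [k _ /= kE|/=];
  first by rewrite kE subnK.
by rewrite -leqNgt => da2; lia.
Qed.

Definition box_covers (b : bool) (d : nat) (m : d.-tuple nat) :
    {set {ffun box m -> option ('I_d * bool)}} :=
  [set f : {ffun box m -> option ('I_d * bool)} |
    [forall k, forall i, forall j, next_in_box k i j ==>
        ((f i == Some (k, true)) == (f j == Some (k, false)))]
    && [forall i, b || (f i != None)]]%SET.

Lemma box_coversP (b : bool) (d : nat) (m : d.-tuple nat)
    (f : {ffun box m -> option ('I_d * bool)}) :
  reflect ((forall k i j, next_in_box k i j ->
              (f i == Some (k, true)) = (f j == Some (k, false)))
           /\ (forall i, b || (f i != None)))
          (f \in box_covers b m).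
Proof.
rewrite inE; apply: (iffP andP) => -[fP fb]; [split=> [k i j ij|i]|split].
- by have /forallP/(_ k)/forallP/(_ i)/forallP/(_ j)/implyP/(_ ij)/eqP := fP.
- by have /forallP := fb.
- apply/forallP => k; apply/forallP => i; apply/forallP => j.
  by apply/implyP => /fP ->.
- exact/forallP.
Qed.

(** [Gamma k a b] says that [a] is [k] exactly when [b] is [k + d], which is the matching condition
    on the two ends of a dimer. Omitting the last color 2d forbids monomers. *)
Lemma card_covers_with (b : bool) (d : nat) (m : d.-tuple nat) :
  #|covers_with (if b then (2 * d).+1 else 2 * d)%N m| = #|box_covers b m|.
Proof.
set c := (if b then _ else _).
have lec (a : 'I_c) : (a <= 2 * d)%N.
  by rewrite -ltnS; apply: leq_trans (ltn_ord a) _; rewrite /c; case: ifP; lia.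
have colE (a : 'I_c) q : (color_of d a == Some q) = (a == color_index (Some q)
  :> nat).
  by apply/eqP/eqP => [<-|->]; rewrite ?color_ofK ?color_indexK.
pose F (f : {ffun box m -> 'I_c}) := [ffun i => color_of d (f i)].
have F_inj : injective F.
  move=> f g /ffunP eqF; apply/ffunP => i; apply/val_inj.
  by have := eqF i; rewrite !ffunE => /(congr1 (@color_index d));
    rewrite !color_ofK.
have FP f : (F f \in box_covers b m) = (f \in covers_with c m).
  rewrite [RHS]inE; apply/box_coversP/forallP => [[fP _] k|fP].
    apply/forallP => i; apply/forallP => j; apply/implyP => /fP.
    by rewrite !ffunE !colE /= /Gamma => ->; case: eqP.
  split=> [k i j ij|i]; last first.
    rewrite ffunE; case: b @c lec colE f F {F_inj fP} => //= _ _ f F.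
    apply: contraTN (ltn_ord (f i)) => /eqP /(congr1 (@color_index d)).
    by rewrite color_ofK /= => [->|]; [lia|have := ltn_ord (f i); lia].
  have /forallP/(_ i)/forallP/(_ j)/implyP/(_ ij) := fP k.
  by rewrite !ffunE !colE /= /Gamma; case: ifP => _ // /negbTE.
rewrite -(card_imset _ F_inj); apply: eq_card => f.
apply/imsetP/idP => [[g gP ->]|fP]; first by rewrite FP.
have lt i : (color_index (f i) < c)%N.
  have /box_coversP[_ /(_ i)] := fP; rewrite /c;
    case: (f i) b {c lec colE F F_inj FP fP}.
    by case=> k [] [] _ /=; have := ltn_ord k; lia.
  by case=> //= _; lia.
have fE : f = F [ffun i => Ordinal (lt i)].
  by apply/ffunP => i; rewrite !ffunE /= color_indexK.
by exists [ffun i => Ordinal (lt i)] => //; rewrite -FP -fE.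
Qed.

(** * Reflection: boxes against doubled tori *)

Definition torus_prev (n : nat) (m : n.-tuple nat) (k : 'I_n) (i : box m)
    : box m :=
  [ffun l : 'I_n => (if l == k then ord_pred (i l) else i l) : 'I_(tnth m l)].

Definition flip (n : nat) (k : 'I_n) (e : {ffun 'I_n -> bool}) :
    {ffun 'I_n -> bool} := [ffun l => (l == k) (+) e l].

(* The torus of sides 2 m_k as 2^n copies of the box, the copy e being reflected
   in the directions k such that e k. *)
Definition fold_next (n : nat) (m : n.-tuple nat) (k : 'I_n)
    (x : {ffun 'I_n -> bool} * box m) : {ffun 'I_n -> bool} * box m :=
  if x.1 k then
    if x.2 k == 0 :> nat then (flip k x.1, x.2) else (x.1, torus_prev k x.2)
  else
    if (x.2 k).+1 == tnth m k then (flip k x.1, x.2)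
    else (x.1, torus_next k x.2).

(** A reflected copy is read backwards from 2 m_k - 1, so mirror copies of one boundary point are
    neighbours: m_k - 1 precedes m_k, and 2 m_k - 1 precedes 0 cyclically. *)
Definition fold_coord (n : nat) (m : n.-tuple nat)
    (x : {ffun 'I_n -> bool} * box m) (k : 'I_n) : nat :=
  (if x.1 k then 2 * tnth m k - (x.2 k).+1 else x.2 k)%N.

Lemma fold_torus_coords (n : nat) (m : n.-tuple nat) :
  torus_coords (@fold_next n m) (fun k => 2 * tnth m k)%N (@fold_coord n m).
Proof.
split=> [[e i] k|[e i] [f j] eqc||k [e i] l].
- rewrite /fold_coord /=; have := ltn_ord (i k).
  by move: (tnth m k) (nat_of_ord (i k)) => t a; case: ifP => _; lia.
- have efij k : e k = f k /\ i k = j k :> nat.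
    have := eqc k; rewrite /fold_coord /=.
    have := ltn_ord (j k); have := ltn_ord (i k).
    move: (tnth m k) (nat_of_ord (i k)) (nat_of_ord (j k)) => t a c.
    by case: (e k) (f k) => [] []; lia.
  congr pair; apply/ffunP => k; first by have [] := efij k.
  by apply/val_inj; have [] := efij k.
- rewrite card_prod card_ffun card_dffun_ord big_split /= prod_nat_const.
  by rewrite card_bool card_ord.
- rewrite /fold_coord /fold_next /=; have := ltn_ord (i l).
  case Ek: (e k); case: eqP => ik /=; rewrite !ffunE; case: eqP => [lk|_] //=;
    rewrite ?lk ?Ek /= in ik *; move: ik; rewrite -?lk.
  + move=> -> t0; have -> : (2 * tnth m l - 1).+1 = (2 * tnth m l)%N by lia.
    by rewrite modnn.
  + move: (tnth m l) (nat_of_ord (i l)) => t a a0 lt_at.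
    rewrite [in RHS]modn_small; last by lia.
    have -> : (a + t).-1 = (a.-1 + t)%N by lia.
    by rewrite modnDr modn_small; lia.
  + move: (tnth m l) (nat_of_ord (i l)) => t a at1 lt_at.
    by rewrite modn_small; lia.
  + move: (tnth m l) (nat_of_ord (i l)) => t a at1 lt_at.
    by rewrite !modn_small; lia.
Qed.

(** Reflecting a direction exchanges the two ends of the dimers along it. *)
Definition reflect_color (d : nat) (e : {ffun 'I_d -> bool})
    (c : option ('I_d * bool)) : option ('I_d * bool) :=
  omap (fun q => (q.1, q.2 (+) e q.1)) c.

Lemma reflect_colorK (d : nat) (e : {ffun 'I_d -> bool}) :
  involutive (reflect_color e).
Proof. by case=> [[k o]|] //=; rewrite addbK. Qed.

Lemma reflect_color_eq (d : nat) (e : {ffun 'I_d -> bool}) c k o :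
  (reflect_color e c == Some (k, o)) = (c == Some (k, o (+) e k)).
Proof. by rewrite (inv_eq (reflect_colorK e)). Qed.

Lemma reflect_color_None (d : nat) (e : {ffun 'I_d -> bool}) c :
  (reflect_color e c == None) = (c == None).
Proof. by rewrite (inv_eq (reflect_colorK e)). Qed.

Lemma next_in_boxE (n : nat) (m : n.-tuple nat) (k : 'I_n) (i j : box m) :
    next_in_box k i j ->
  [/\ (i k).+1 != tnth m k, j k != 0 :> nat, torus_next k i = j
    & torus_prev k j = i].
Proof.
case/andP => /eqP jk /forallP jl; have ltjk := ltn_ord (j k).
have jE l : l != k -> j l = i l.
  by move=> lk; have /implyP/(_ lk)/eqP := jl l => /val_inj.
split; first by rewrite -jk neq_ltn ltjk.
- by rewrite jk.
- apply/ffunP => l; rewrite ffunE; case: eqP => [->|/eqP/jE //].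
  by apply/val_inj; rewrite /= modn_small -jk.
- apply/ffunP => l; rewrite ffunE; case: eqP => [->|/eqP/jE //].
  apply/val_inj; rewrite /= jk addSn /= addnC modnDl modn_small //.
Qed.

Definition box_boundary (n : nat) (m : n.-tuple nat) : {set box m} :=
  [set i : box m |
    [exists k, (i k == 0 :> nat) || ((i k).+1 == tnth m k)]]%SET.

(** A torus cover restricts to a box cover on each of the 2^d copies, once the reflections are
    undone; dimers crossing between copies become protruding ones. *)
Lemma card_fold_le (b : bool) (d : nat) (m : d.-tuple nat) :
  (#|torus_covers b (@fold_next d m)| <= #|box_covers b m| ^ (2 ^ d))%N.
Proof.
pose G (f : {ffun {ffun 'I_d -> bool} * box m -> option ('I_d * bool)}) :=
  [ffun e => [ffun i => reflect_color e (f (e, i))]].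
have G_inj : injective G.
  move=> f g /ffunP eqG; apply/ffunP => -[e i].
  have /ffunP/(_ i) := eqG e; rewrite !ffunE.
  exact: (inv_inj (reflect_colorK e)).
rewrite -[X in (_ <= _ ^ X)%N](_ : #|{ffun 'I_d -> bool}| = _); last first.
  by rewrite card_ffun card_bool card_ord.
rewrite -card_ffun_on -(card_imset _ G_inj).
apply/subset_leq_card/fintype.subsetP => _ /imsetP[f /torus_coversP[fP fb] ->].
apply/ffun_onP => e; apply/box_coversP; rewrite ffunE.
split=> [k i j ij|i]; rewrite !ffunE ?reflect_color_None ?fb //.
rewrite !reflect_color_eq; have [ik jk ijE jiE] := next_in_boxE ij.
case Ek: (e k) => /=.
  by have := fP k (e, j); rewrite /fold_next /= Ek (negPf jk) jiE.
by have := fP k (e, i); rewrite /fold_next /= Ek (negPf ik) ijE.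
Qed.

(* Box covers agreeing on the boundary glue, after reflection, to a cover of the
   doubled torus; the boundary values are chosen by pigeonhole. *)
Lemma card_box_covers_le (b : bool) (d : nat) (m : d.-tuple nat) :
  (#|box_covers b m| ^ (2 ^ d)
     <= (2 * d).+1 ^ (#|box_boundary m| * 2 ^ d)
        * #|torus_covers b (@fold_next d m)|)%N.
Proof.
pose trace_of (f : {ffun box m -> option ('I_d * bool)}) :=
  [ffun i => if i \in box_boundary m then f i else None].
pose W p := [set f in box_covers b m | trace_of f == p]%SET.
have W_le p : (#|W p| ^ (2 ^ d) <= #|torus_covers b (@fold_next d m)|)%N.
  pose H (h : {ffun {ffun 'I_d -> bool} -> {ffun box m -> option ('I_d *
    bool)}}) :=
    [ffun x : {ffun 'I_d -> bool} * box m => reflect_color x.1 (h x.1 x.2)].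
  have H_inj : injective H.
    move=> f g /ffunP eqH; apply/ffunP => e; apply/ffunP => i.
    by have := eqH (e, i); rewrite !ffunE => /(inv_inj (reflect_colorK e)).
  rewrite -[X in (_ ^ X <= _)%N](_ : #|{ffun 'I_d -> bool}| = _); last first.
    by rewrite card_ffun card_bool card_ord.
  rewrite -card_ffun_on -(card_imset _ H_inj).
  apply/subset_leq_card/fintype.subsetP => _ /imsetP[h /ffun_onP hW ->].
  have bdE i e e' : i \in box_boundary m -> h e i = h e' i.
    move=> ib; have /setIdP[_ /eqP/ffunP/(_ i)] := hW e.
    by have /setIdP[_ /eqP <-] := hW e'; rewrite !ffunE ib.
  have hP e : (forall k i j, next_in_box k i j ->
      (h e i == Some (k, true)) = (h e j == Some (k, false)))
      /\ (forall i, b || (h e i != None)).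
    by have /setIdP[/box_coversP] := hW e.
  apply/torus_coversP; split=> [k [e i]|[e i]]; last first.
    by rewrite ffunE reflect_color_None; have [_] := hP e.
  have nextP (i' j : box m) : (j k == (i' k).+1 :> nat) ->
      (forall l, l != k -> j l = i' l) -> next_in_box k i' j.
    by move=> jk jl; rewrite /next_in_box jk; apply/forallP => l;
      apply/implyP => /jl ->.
  rewrite !ffunE !reflect_color_eq /fold_next /=.
  case Ek: (e k) => /=; case: ifP => /eqP ik /=; rewrite ?ffunE ?eqxx ?Ek /=.
  (* Across the wall lies the same box point in the flipped copy. The flip also exchanges the ends,
     so both sides ask for the same color of [h]: a protruding dimer is joined to its mirror
     image. *)
  - by rewrite (bdE _ (flip k e) e) // inE; apply/existsP; exists k; rewrite ik.
  - have [/(_ k (torus_prev k i) i) -> //] := hP e.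
    apply: nextP => [|l lk]; rewrite ffunE ?eqxx ?(negPf lk) //=.
    case: (i k) ik => [[|a] ai] //= _.
    by rewrite modnDr modn_small // ltnW.
  - by rewrite (bdE _ (flip k e) e) // inE; apply/existsP; exists k;
    rewrite ik eqxx orbT.
  - have [/(_ k i (torus_next k i)) -> //] := hP e.
    apply: nextP => [|l lk]; rewrite ffunE ?eqxx ?(negPf lk) //=.
    by rewrite modn_small //; have := ltn_ord (i k);
      rewrite leq_eqVlt => /predU1P[].
(* The most frequent boundary value; its class has at least the average size. *)
have [p pmax] : exists p, forall p', (#|W p'| <= #|W p|)%N.
  case: (@arg_maxnP _ [ffun _ => None] xpredT (fun p => #|W p|) isT) => p _ pP.
  by exists p => p'; apply: pP.
have -> : ((2 * d).+1 ^ (#|box_boundary m| * 2 ^ d)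
    = ((2 * d).+1 ^ #|box_boundary m|) ^ (2 ^ d))%N by rewrite expnM.
apply: leq_trans (leq_mul (leqnn _) (W_le p));
  rewrite -expnMn leq_exp2r ?expn_gt0 //.
have -> : (2 * d).+1 = #|{: option ('I_d * bool)}|.
  by rewrite card_option card_prod card_ord card_bool mulnC.
rewrite -(card_pffun_on None) -sum_nat_const -sum1_card.
rewrite (partition_big trace_of (mem (pffun_on None (mem (box_boundary m))
  predT))) /=.
  apply: leq_sum => p' _; apply: leq_trans (pmax p').
  by rewrite sum1dep_card leq_eqVlt; apply/orP; left; apply/eqP/eq_card => f;
    rewrite !inE.
move=> f _; apply/pffun_onP; split=> [|x] //.
by apply/supportP => i ib; rewrite ffunE (negPf ib).
Qed.

(** Overwriting coordinate [k] by an arbitrary value is injective on the slice, where the lost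
    coordinate is known to be [v]. *)
Lemma card_box_slice (n : nat) (m : n.-tuple nat) (k : 'I_n) (v : nat) :
  (#|[set i : box m | i k == v :> nat]%SET| * tnth m k <= prod_norm m)%N.
Proof.
set A := [set i | _]%SET;
  rewrite -[tnth m k]card_ord -cardsT -cardsX -[prod_norm m]card_dffun_ord.
pose F (x : box m * 'I_(tnth m k)) : box m :=
  [ffun l => @eqtype.dfwith _ (fun l => 'I_(tnth m l)) x.1 k x.2 l].
rewrite -(@card_in_imset _ _ F) ?max_card //.
move=> [i a] [j c] /setXP[+ _] /setXP[+ _]; rewrite !inE /= => /eqP ik /eqP jk.
move/ffunP=> eqF; have := eqF k; rewrite !ffunE !dfwith_in /= => <-.
congr pair; apply/ffunP => l; have [->|kl] := eqVneq l k.
  by apply/val_inj; rewrite /= ik jk.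
by have := eqF l; rewrite !ffunE !dfwith_out // eq_sym.
Qed.

Lemma card_box_boundary (n : nat) (m : n.-tuple nat) :
  (#|box_boundary m| <= \sum_k (#|[set i : box m | i k == 0 :> nat]%SET|
     + #|[set i : box m | i k == (tnth m k).-1 :> nat]%SET|))%N.
Proof.
apply: (@leq_trans (\sum_k #|[set i : box m |
    (i k == 0 :> nat) || (i k == (tnth m k).-1 :> nat)]%SET|)); last first.
  apply: leq_sum => k _; rewrite -cardsUI; apply: leq_trans (leq_addr _ _).
  by apply/subset_leq_card/fintype.subsetP => i; rewrite !inE.
have -> : box_boundary m = (\bigcup_k [set i : box m |
    (i k == 0 :> nat) || (i k == (tnth m k).-1 :> nat)])%SET.
  apply/setP => i; rewrite inE; apply/existsP/bigcupP => -[k].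
    by move=> ik; exists k => //; rewrite inE; move: ik; lia.
  move=> _; rewrite inE => ik; exists k; move: ik; have := ltn_ord (i k); lia.
by elim/big_rec2: _ => [|k a A _ le];
  rewrite ?cards0 // (leq_trans (leq_card_setU _ _)) // leq_add2l.
Qed.

(** * Existence of the limit and its comparison with finite bounds *)

Definition positive_sides (d : nat) (m : d.-tuple nat) : Prop :=
  forall k, (0 < tnth m k)%N.

Definition inv_sum (R : realType) (d : nat) (m : d.-tuple nat) : R :=
  \sum_k (tnth m k)%:R^-1.

Lemma inv_sum_small (R : realType) (d : nat) (C e : R) : 0 < e ->
  exists N : nat, forall m : d.-tuple nat, (forall k, (N <= tnth m k)%N) ->
    positive_sides m /\ C * inv_sum R m <= e.
Proof.
move=> e0; pose c := `|C| * d%:R / e.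
have c0 : 0 <= c by rewrite divr_ge0 ?mulr_ge0 // ltW.
exists (Num.bound c).+1 => m mN.
split=> [k|]; first exact: leq_trans (mN k).
apply: le_trans (ler_wpM2r _ (ler_norm C)) _.
  by apply: sumr_ge0 => k _; rewrite invr_ge0.
have N0 : 0 < (Num.bound c).+1%:R :> R by rewrite ltr0n.
apply: (@le_trans _ _ (`|C| * (d%:R * (Num.bound c).+1%:R^-1))).
  apply: ler_wpM2l => //; rewrite mulr_natl -[X in _ *+ X]card_ord -sumr_const.
  apply: ler_sum => k _; rewrite lef_pV2 ?posrE ?ler_nat ?mN //.
  by rewrite ltr0n; apply: leq_trans (mN k).
rewrite mulrA ler_pdivrMr // -ler_pdivrMl // mulrC -/c.
by apply: le_trans (ltW (archi_boundP c0)) _; rewrite ler_nat.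
Qed.

Lemma le_of_le_inv_sum (R : realType) (d : nat) (x y C : R) :
  (forall m : d.-tuple nat, positive_sides m -> x <= y + C * inv_sum R m) ->
  x <= y.
Proof.
move=> le; apply/ler_addgt0Pr => e e0.
have [N NP] := inv_sum_small d C e0.
have [|m0 Ce] := NP [tuple N | k < d]; first by move=> k; rewrite tnth_mktuple.
by apply: le_trans (le _ m0) _; rewrite lerD2l.
Qed.

(** The two hypotheses on [a] make it converge to the infimum of [E]. In the second conclusion the
    error may depend on the same [m] as [E m]: since [E m <= a m <= E m' + C' * inv_sum R m],
    letting [m] grow with [m'] fixed gives [x <= E m']. *)
Lemma lim_multi_infty (R : realType) (d : nat) (a E : d.-tuple nat -> R) :
    (forall m, 0 <= E m) ->
    (forall m, positive_sides m -> E m <= a m) ->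
    (forall m', positive_sides m' -> exists C, forall m, positive_sides m ->
       a m <= E m' + C * inv_sum R m) ->
  let l := lim (a m @[m --> @multi_infty d])%classic in
  (forall m, positive_sides m -> l <= E m) /\
  (forall x C, (forall m, positive_sides m -> x <= E m + C * inv_sum R m) ->
     x <= l).
Proof.
move=> E0 Ea aE /=; pose S := [set E m | m in @positive_sides d]%classic.
have S0 : (S !=set0)%classic.
  exists (E [tuple 1%N | k < d]), [tuple 1%N | k < d] => // k.
  by rewrite tnth_mktuple.
have lbS : has_inf S by split=> //; exists 0 => _ [m _ <-].
have infE m : positive_sides m -> inf S <= E m.
  by move=> m0; apply: ge_inf; [case: lbS|exists m].
have -> : lim (a m @[m --> @multi_infty d])%classic = inf S.
  apply: cvg_lim => //; apply/cvgrPdist_le => e e0.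
  have e20 : 0 < e / 2 by rewrite divr_gt0.
  have [_ [m' m'0 <-] Em'] := inf_adherent e20 lbS.
  have [C aC] := aE _ m'0; have [N NP] := inv_sum_small d C e20.
  exists N => // m /NP[m0 Ce]; rewrite distrC ger0_norm.
    by have := aC _ m0; lra.
  by rewrite subr_ge0; apply: le_trans (infE _ m0) (Ea _ m0).
split=> // x C xE; apply: lb_le_inf => // _ [m' m'0 <-].
have [C' aC'] := aE _ m'0.
apply: (@le_of_le_inv_sum _ d _ _ (C + C')) => m m0.
by have := xE _ m0; have := Ea _ m0; have := aC' _ m0; lra.
Qed.

Lemma fold_stack_covers (b : bool) (n : nat) (m : n.+1.-tuple nat)
    (m' : n.-tuple nat) :
    (forall j, tnth m' j = 2 * tnth m (lift ord_max j))%N ->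
  #|stack_covers b m' (2 * tnth m ord_max)|
    = #|torus_covers b (@fold_next n.+1 m)|.
Proof.
move=> m'E.
have c1 := stack_torus_coords (2 * tnth m ord_max) (box_torus_coords m').
have c2 := fold_torus_coords m.
apply: (card_torus_covers_coords b c1 c2
  (g := fun k => if k is Some j then lift ord_max j else ord_max)).
  exists (unlift ord_max) => [[j|]|k]; rewrite ?liftK ?unlift_none //.
  by case: unliftP.
by case=> [j|] //=; rewrite m'E.
Qed.

Lemma box_boundary_le (R : realType) (d : nat) (m : d.-tuple nat) :
    positive_sides m ->
  #|box_boundary m|%:R <= (prod_norm m)%:R * (2 * inv_sum R m).
Proof.
move=> m0; have := card_box_boundary m; rewrite -(ler_nat R) => /le_trans;
  apply.
rewrite natr_sum !mulr_sumr; apply: ler_sum => k _.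
rewrite mulrA ler_pdivlMr ?ltr0n // -!natrM ler_nat muln2 -addnn mulnDl.
by rewrite leq_add // card_box_slice.
Qed.

(** Logarithms of the two reflection inequalities. Two faces per direction give at most
    [2 * inv_sum R m] boundary points per point of the box, each with 2d + 1 possible colors, where
    d is [n.+1]. *)
Lemma ln_box_covers_bounds (R : realType) (b : bool) (n : nat)
    (m : n.+1.-tuple nat) (m' : n.-tuple nat) :
    (forall j, tnth m' j = 2 * tnth m (lift ord_max j))%N ->
    positive_sides m ->
  let z : R := ln #|stack_covers b m' (2 * tnth m ord_max)|%:R
               / (2 ^ n.+1 * prod_norm m)%:R in
  let a : R := ln #|box_covers b m|%:R / (prod_norm m)%:R in
  z <= a <= z + 2 * ln (2 * n.+1).+1%:R * inv_sum R m.
Proof.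
move=> m'E m0 /=.
have vol0 : 0 < (prod_norm m)%:R :> R by rewrite ltr0n prodn_gt0.
have Z1 : (0 < #|stack_covers b m' (2 * tnth m ord_max)|)%N.
  by rewrite -(ltr0n R) stack_covers_gt0.
have := card_fold_le b m; have := card_box_covers_le b m.
rewrite -(fold_stack_covers b m'E).
move: (#|stack_covers _ _ _|) Z1 => Z Z1.
set W := #|box_covers b m| => WZ ZW.
have W1 : (0 < W)%N.
  by rewrite lt0n; apply: contraTneq ZW => ->;
    rewrite exp0n ?expn_gt0 // -ltnNge.
have D0 : 0 < (2 ^ n.+1)%:R :> R by rewrite ltr0n expn_gt0.
have ZWln : ln Z%:R <= (2 ^ n.+1)%:R * ln W%:R :> R.
  rewrite mulr_natl -lnXn ?ltr0n // ler_ln ?posrE ?exprn_gt0 ?ltr0n //.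
  by rewrite -natrX ler_nat.
have c1 : 0 <= ln (2 * n.+1).+1%:R :> R by rewrite ln_ge0 // ler1n.
have WZln : (2 ^ n.+1)%:R * ln W%:R
    <= (#|box_boundary m| * 2 ^ n.+1)%:R * ln (2 * n.+1).+1%:R + ln Z%:R :> R.
  rewrite !mulr_natl -!lnXn ?ltr0n // -lnM ?posrE ?exprn_gt0 ?ltr0n //.
  rewrite ler_ln ?posrE ?mulr_gt0 ?exprn_gt0 ?ltr0n //.
  by rewrite -!natrX -natrM ler_nat.
rewrite natrM; apply/andP; split.
  by rewrite ler_pdivrMr ?mulr_gt0 // mulrCA divfK ?gt_eqF.
have -> : ln W%:R / (prod_norm m)%:R
    = ((2 ^ n.+1)%:R * ln W%:R) / ((2 ^ n.+1)%:R * (prod_norm m)%:R) :> R.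
  by field; rewrite !gt_eqF.
apply: (le_trans (ler_wpM2r _ WZln)); first by rewrite invr_ge0 mulr_ge0.
rewrite mulrDl addrC lerD2l ler_pdivrMr ?mulr_gt0 // natrM.
have := ler_wpM2r (mulr_ge0 (ltW D0) c1) (@box_boundary_le R _ _ m0).
by congr (_ <= _); ring.
Qed.

Definition box_entropy (R : realType) (b : bool) (d : nat) : R :=
  lim (ln (#|@box_covers b d m|%:R : R) / (prod_norm m)%:R
         @[m --> @multi_infty d])%classic.

Lemma h_box_entropy (R : realType) (d : nat) : h R d = box_entropy R true d.
Proof.
rewrite /h /box_entropy.
by under eq_fun do rewrite /monomer_dimer_covers (card_covers_with true).
Qed.

Lemma h_tilde_box_entropy (R : realType) (d : nat) :
  h_tilde R d = box_entropy R false d.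
Proof.
rewrite /h_tilde /box_entropy.
by under eq_fun do rewrite /dimer_covers (card_covers_with false).
Qed.

Lemma ln2_half_le (R : realType) (k : nat) :
  ln 2 / (2 * k)%:R <= ln 2 / k%:R :> R.
Proof.
case: k => [|k]; first by rewrite muln0.
have log2 : 0 <= ln 2 :> R by rewrite ln_ge0 // ler1n.
rewrite ler_pdivrMr ?ltr0n // mulrAC ler_pdivlMr ?ltr0n //.
by rewrite ler_wpM2l // ler_nat; lia.
Qed.

Lemma inv_sum2 (R : realType) (m : 2.-tuple nat) :
  inv_sum R m = (tnth m ord0)%:R^-1 + (tnth m ord_max)%:R^-1.
Proof.
rewrite /inv_sum big_ord_recr /= big_ord1.
by congr ((tnth m _)%:R^-1 + (tnth m _)%:R^-1); apply/val_inj.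
Qed.

(** * The bounds in dimension 2 *)

Definition ln_beta1 (R : realType) (b : bool) (a : nat) : R :=
  if a == 0%N then ln 2 else ln_beta R b [tuple a].

Definition ln_beta2 (R : realType) (b : bool) (a c : nat) : R :=
  if a == 0%N then c%:R * ln 2 else if c == 0%N then a%:R * ln 2
  else ln_beta R b [tuple a; c].

Lemma prod_norm1 (a : nat) : prod_norm [tuple a] = a.
Proof. by rewrite /prod_norm big_ord1. Qed.

Lemma prod_norm2 (a c : nat) : prod_norm [tuple a; c] = (a * c)%N.
Proof. by rewrite /prod_norm !big_ord_recr /= big_ord0 mul1n. Qed.

(** Both sides describe the n by 2r torus; [ln 2 / n] is the logarithm of the matrix size 2^(2r)
    divided by the area. *)
Lemma ln_beta1_le (R : realType) (b : bool) (n r : nat) :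
    (0 < n)%N -> (0 < r)%N ->
  ln_beta R b [tuple n] / n%:R
    <= ln_beta R b [tuple (2 * r)%N] / (2 * r)%:R + ln 2 / n%:R.
Proof.
move=> n0 r0; have := ln_beta_cut_le R r0 n0 (stack_covers1_swap b n (2 * r)).
rewrite prod_norm1.
have N0 : 0 < n%:R :> R by rewrite ltr0n.
have Q0 : 0 < (2 * r)%:R :> R by rewrite ltr0n muln_gt0.
move: (ln_beta R b [tuple n]) (ln_beta R b [tuple (2 * r)%N]) => x y le.
(* The difference of the two sides is the slack in [le] divided by the area; the same device recurs
   below. *)
rewrite -subr_ge0 [X in 0 <= X](_ : _
  = ((2 * r)%:R * ln 2 + n%:R * y - (2 * r)%:R * x) / ((2 * r)%:R * n%:R)).
  by rewrite divr_ge0 ?subr_ge0 // mulr_ge0 ?ltW.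
by field; rewrite ?pnatr_eq0; lia.
Qed.

(** For q = 0 the trace of the zeroth power over the circle of length 2k contributes 2k ln 2, which
    is 2k times the logarithm of the convention beta(0) = 2. *)
Lemma ln_beta1_ge (R : realType) (b : bool) (p q k : nat) :
    (0 < p)%N -> (0 < k)%N ->
  (ln_beta1 R b (p + 2 * q) - ln_beta1 R b (2 * q)) / p%:R
    <= ln_beta R b [tuple (2 * k)%N] / (2 * k)%:R
       + (2 * q)%:R * ln 2 / p%:R / (2 * k)%:R.
Proof.
move=> p0 k0.
have := ln_beta_cutD_le R p0 k0 (stack_covers1_swap b (2 * k) (p + 2 * q))
  (stack_covers1_swap b (2 * k) (2 * q)).
rewrite !prod_norm1 /ln_beta1 addn_eq0 (gtn_eqF p0) /=.
have P0 : 0 < p%:R :> R by rewrite ltr0n.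
have K0 : 0 < (2 * k)%:R :> R by rewrite ltr0n muln_gt0.
rewrite (muln_eq0 2 q) /=; move=> le.
have {}le : (2 * k)%:R * ln_beta R b [tuple (p + 2 * q)%N]
    <= p%:R * ln_beta R b [tuple (2 * k)%N] + ((2 * q)%:R * ln 2
       + (2 * k)%:R * (if q == 0%N then ln 2 else ln_beta R b [tuple (2 *
         q)%N])).
  apply: (le_trans le); rewrite lerD2l; case: (q =P 0%N) => // ->.
  by rewrite muln0 mul0r add0r.
move: le; move: (ln_beta R b [tuple (p + 2 * q)%N]) (ln_beta R b [tuple (2 *
  k)%N])
  (if _ then _ else _) => x y z le.
rewrite -subr_ge0 [X in 0 <= X](_ : _
  = (p%:R * y + ((2 * q)%:R * ln 2 + (2 * k)%:R * z) - (2 * k)%:R * x)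
    / ((2 * k)%:R * p%:R)).
  by rewrite divr_ge0 ?subr_ge0 // mulr_ge0 ?ltW.
by field; rewrite ?pnatr_eq0; lia.
Qed.

Lemma entropy2_bounds (R : realType) (b : bool) (p r q : nat) :
    (0 < p)%N -> (0 < r)%N ->
  ln_beta1 R b (2 * r) / (2 * r)%:R >= box_entropy R b 2 /\
  box_entropy R b 2 >=
    (ln_beta1 R b (p + 2 * q) - ln_beta1 R b (2 * q)) / p%:R.
Proof.
move=> p0 r0.
(* [E] depends on the first side only: the last direction is the height of the stack. *)
pose E (m : 2.-tuple nat) :=
  ln_beta R b [tuple (2 * tnth m ord0)%N] / (2 * tnth m ord0)%:R.
have log2 : 0 <= ln 2 :> R by rewrite ln_ge0 // ler1n.
have sidesE (m : 2.-tuple nat) (j : 'I_1) :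
    (tnth [tuple (2 * tnth m ord0)%N] j = 2 * tnth m (lift ord_max j))%N.
  by rewrite ord1; congr (2 * tnth m _)%N; apply/val_inj.
have volE (m : 2.-tuple nat) :
    prod_norm m = (tnth m ord0 * tnth m ord_max)%N.
  by rewrite /prod_norm big_ord_recr big_ord1; do 2?congr (tnth m _ * _)%N;
    apply/val_inj.
have [||| lim_le lim_ge] := @lim_multi_infty R 2
    (fun m => ln #|box_covers b m|%:R / (prod_norm m)%:R) E.
- by move=> m; rewrite divr_ge0 ?ln_beta_ge0.
- move=> m m0; have /andP[+ _] := ln_box_covers_bounds R b (sidesE m) m0.
  apply: le_trans.
  have := ln_stack_covers_ge R b [tuple (2 * tnth m ord0)%N] (m0 ord_max).
  rewrite /E volE; have := m0 ord0; have := m0 ord_max.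
  move: (ln_beta R b _) (ln _) => x z.
  move: (tnth m ord0) (tnth m ord_max) => a c c0 a0 le.
  rewrite -subr_ge0 [X in 0 <= X](_ : _
    = (z - (2 * c)%:R * x) / (2 ^ 2 * (a * c))%:R).
    by rewrite divr_ge0 ?subr_ge0.
  by field; rewrite ?pnatr_eq0; lia.
(* [ln 2] pays for cutting the torus in two ways, [2 * ln 5] for the boundary of the box. *)
- move=> m' m'0; exists (ln 2 + 2 * ln (2 * 2).+1%:R) => m m0.
  have /andP[_] := ln_box_covers_bounds R b (sidesE m) m0.
  move=> /le_trans; apply; rewrite (mulrDl (ln 2)) addrA lerD2r.
  have a0 : (0 < 2 * tnth m ord0)%N by rewrite muln_gt0 m0.
  have c0 : (0 < 2 * tnth m ord_max)%N by rewrite muln_gt0 m0.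
  have := ln_stack_covers_le R b [tuple (2 * tnth m ord0)%N] c0.
  have := ln_beta1_le R b a0 (m'0 ord0).
  rewrite /E volE prod_norm1 inv_sum2; have := m0 ord0; have := m0 ord_max.
  move: (ln_beta R b [tuple (2 * tnth m' ord0)%N] / _) (ln_beta R b _) (ln
    #|_|%:R).
  move=> y x z; move: {a0 c0} (tnth m ord0) (tnth m ord_max).
  move=> a c c0 a0 le_xy le_z.
  have {}le_z : z / (2 ^ 2 * (a * c))%:R <= ln 2 / (2 * c)%:R + x / (2 * a)%:R.
    rewrite -subr_ge0 [X in 0 <= X](_ : _
      = ((2 * a)%:R * ln 2 + (2 * c)%:R * x - z) / (2 ^ 2 * (a * c))%:R).
      by rewrite divr_ge0 ?subr_ge0.
    by field; rewrite ?pnatr_eq0; lia.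
  by have := ln2_half_le R a; have := ln2_half_le R c; lra.
split.
  have := lim_le [tuple r; 1%N]; rewrite /E /ln_beta1 muln_eq0 (gtn_eqF r0) /=.
  by apply=> k; case: (unliftP ord0 k) => [j ->|->] //; rewrite ord1.
apply: (lim_ge _ (q%:R * ln 2 / p%:R)) => m m0.
apply: le_trans (ln_beta1_ge R b q p0 (m0 ord0)) _; rewrite /E lerD2l inv_sum2.
rewrite mulrDr -[X in X <= _]addr0 lerD ?mulr_ge0 ?invr_ge0 //.
rewrite le_eqVlt; apply/orP; left; apply/eqP; field.
by rewrite ?pnatr_eq0; have := m0 ord0; lia.
Qed.

(** * The bounds in dimension 3 *)

Lemma ln_beta2_lel (R : realType) (b : bool) (n c r : nat) :
    (0 < n)%N -> (0 < c)%N -> (0 < r)%N ->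
  ln_beta R b [tuple n; c] / (n * c)%:R
    <= ln_beta R b [tuple (2 * r)%N; c] / (2 * r * c)%:R + ln 2 / n%:R.
Proof.
move=> n0 c0 r0; have := ln_beta_cut_le R r0 n0 (stack_covers2_swapl b n c (2 *
  r)).
rewrite prod_norm2.
move: (ln_beta R b [tuple n; c]) (ln_beta R b [tuple (2 * r)%N; c]) => x y le.
rewrite -subr_ge0 [X in 0 <= X](_ : _
  = ((2 * r * c)%:R * ln 2 + n%:R * y - (2 * r)%:R * x) / (2 * r * c * n)%:R).
  by rewrite divr_ge0 ?subr_ge0.
by field; rewrite ?pnatr_eq0; lia.
Qed.

Lemma ln_beta2_ler (R : realType) (b : bool) (a n t : nat) :
    (0 < a)%N -> (0 < n)%N -> (0 < t)%N ->
  ln_beta R b [tuple a; n] / (a * n)%:R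
    <= ln_beta R b [tuple a; (2 * t)%N] / (a * (2 * t))%:R + ln 2 / n%:R.
Proof.
move=> a0 n0 t0; have := ln_beta_cut_le R t0 n0 (stack_covers2_swapr b a n (2 *
  t)).
rewrite prod_norm2.
move: (ln_beta R b [tuple a; n]) (ln_beta R b [tuple a; (2 * t)%N]) => x y le.
rewrite -subr_ge0 [X in 0 <= X](_ : _
  = ((a * (2 * t))%:R * ln 2 + n%:R * y - (2 * t)%:R * x) / (a * (2 * t) *
    n)%:R).
  by rewrite divr_ge0 ?subr_ge0.
by field; rewrite ?pnatr_eq0; lia.
Qed.

Lemma ln_beta2_gel (R : realType) (b : bool) (p q k c : nat) :
    (0 < p)%N -> (0 < k)%N -> (0 < c)%N ->
  ln_beta2 R b (p + 2 * q) c / c%:R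
    <= p%:R * (ln_beta R b [tuple (2 * k)%N; c] / (2 * k * c)%:R)
       + ln_beta2 R b (2 * q) c / c%:R + (2 * q)%:R * ln 2 / (2 * k)%:R.
Proof.
move=> p0 k0 c0.
have := ln_beta_cutD_le R p0 k0 (stack_covers2_swapl b (2 * k) c (p + 2 * q))
  (stack_covers2_swapl b (2 * k) c (2 * q)).
rewrite !prod_norm2 /ln_beta2 addn_eq0 (gtn_eqF p0) (gtn_eqF c0) /=.
rewrite (muln_eq0 2 q) /=; move=> le.
have {}le : (2 * k)%:R * ln_beta R b [tuple (p + 2 * q)%N; c]
    <= p%:R * ln_beta R b [tuple (2 * k)%N; c] + ((2 * q * c)%:R * ln 2
       + (2 * k)%:R * (if q == 0%N then c%:R * ln 2
                       else ln_beta R b [tuple (2 * q)%N; c])).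
  apply: (le_trans le); rewrite lerD2l; case: (q =P 0%N) => // ->.
  by rewrite muln0 mul0n mul0r add0r natrM mulrA.
move: le; move: (ln_beta R b [tuple (p + 2 * q)%N; c])
  (ln_beta R b [tuple (2 * k)%N; c]) (if _ then _ else _) => x y z le.
rewrite -subr_ge0 [X in 0 <= X](_ : _
  = (p%:R * y + ((2 * q * c)%:R * ln 2 + (2 * k)%:R * z) - (2 * k)%:R * x)
    / (2 * k * c)%:R).
  by rewrite divr_ge0 ?subr_ge0.
by field; rewrite ?pnatr_eq0; lia.
Qed.

Lemma ln_beta2_ger (R : realType) (b : bool) (a u s k : nat) :
    (0 < a)%N -> (0 < u)%N -> (0 < k)%N ->
  ln_beta2 R b a (u + 2 * s) - ln_beta2 R b a (2 * s)
    <= u%:R * (ln_beta R b [tuple a; (2 * k)%N] / (2 * k)%:R)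
       + (a * (2 * s))%:R * ln 2 / (2 * k)%:R.
Proof.
move=> a0 u0 k0.
have := ln_beta_cutD_le R u0 k0 (stack_covers2_swapr b a (2 * k) (u + 2 * s))
  (stack_covers2_swapr b a (2 * k) (2 * s)).
rewrite !prod_norm2 /ln_beta2 addn_eq0 (gtn_eqF u0) (gtn_eqF a0) /=.
rewrite (muln_eq0 2 s) /=; move=> le.
have {}le : (2 * k)%:R * ln_beta R b [tuple a; (u + 2 * s)%N]
    <= u%:R * ln_beta R b [tuple a; (2 * k)%N] + ((a * (2 * s))%:R * ln 2
       + (2 * k)%:R * (if s == 0%N then a%:R * ln 2
                       else ln_beta R b [tuple a; (2 * s)%N])).
  apply: (le_trans le); rewrite lerD2l; case: (s =P 0%N) => // ->.
  by rewrite !muln0 mul0r add0r natrM mulrCA mulrA.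
move: le; move: (ln_beta R b [tuple a; (u + 2 * s)%N])
  (ln_beta R b [tuple a; (2 * k)%N]) (if _ then _ else _) => x y z le.
rewrite -subr_ge0 [X in 0 <= X](_ : _
  = (u%:R * y + ((a * (2 * s))%:R * ln 2 + (2 * k)%:R * z) - (2 * k)%:R * x)
    / (2 * k)%:R).
  by rewrite divr_ge0 ?subr_ge0.
by field; rewrite ?pnatr_eq0; lia.
Qed.

(** This replaces the growing side [c] by the fixed side [2 * v] in the term subtracted from the
    lower bound. For q = 0 both quotients equal [ln 2], by the convention beta(0, n) = 2^n. *)
Lemma ln_beta2_even_le (R : realType) (b : bool) (q v c : nat) :
    (0 < v)%N -> (0 < c)%N ->
  ln_beta2 R b (2 * q) c / c%:R
    <= ln_beta2 R b (2 * q) (2 * v) / (2 * v)%:R + (2 * q)%:R * ln 2 / c%:R.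
Proof.
move=> v0 c0; rewrite /ln_beta2 !muln_eq0 /= (gtn_eqF c0) (gtn_eqF v0).
have [->|q0] := posnP q.
  rewrite muln0 !mul0r addr0 le_eqVlt; apply/orP; left; apply/eqP.
  by field; rewrite ?pnatr_eq0; lia.
have qq0 : (0 < 2 * q)%N by rewrite muln_gt0.
have := ln_beta2_ler R b qq0 c0 v0.
move: (ln_beta R b [tuple (2 * q)%N; c]) (ln_beta R b [tuple (2 * q)%N;
  (2 * v)%N]).
move=> x y le; rewrite -subr_ge0 [X in 0 <= X](_ : _ = (2 * q)%:R *
    (y / (2 * q * (2 * v))%:R + ln 2 / c%:R - x / (2 * q * c)%:R)).
  by rewrite mulr_ge0 ?subr_ge0.
by field; rewrite ?pnatr_eq0; lia.
Qed.

Lemma entropy3_bounds (R : realType) (b : bool) (p r t u v q s : nat) :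
    (0 < p)%N -> (0 < r)%N -> (0 < t)%N -> (0 < u)%N -> (0 < v)%N ->
  ln_beta2 R b (2 * r) (2 * t) / (4 * r * t)%:R >= box_entropy R b 3 /\
  box_entropy R b 3 >=
    (ln_beta2 R b (p + 2 * q) (u + 2 * s) - ln_beta2 R b (p + 2 * q) (2 * s))
      / (u * p)%:R
    - ln_beta2 R b (2 * q) (2 * v) / (2 * v * p)%:R.
Proof.
move=> p0 r0 t0 u0 v0.
pose i1 : 'I_3 := lift ord_max ord_max.
pose sides (m : 3.-tuple nat) := [tuple (2 * tnth m ord0)%N; (2 * tnth m i1)%N].
pose E (m : 3.-tuple nat) :=
  ln_beta R b (sides m) / (2 * tnth m ord0 * (2 * tnth m i1))%:R.
have log2 : 0 <= ln 2 :> R by rewrite ln_ge0 // ler1n.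
have sidesE (m : 3.-tuple nat) (j : 'I_2) :
    (tnth (sides m) j = 2 * tnth m (lift ord_max j))%N.
  case: (unliftP ord_max j) => [j' ->|->] //; rewrite ord1.
  by congr (2 * tnth m _)%N; apply/val_inj.
have volE (m : 3.-tuple nat) :
    prod_norm m = (tnth m ord0 * tnth m i1 * tnth m ord_max)%N.
  rewrite /prod_norm !big_ord_recr /= big_ord0 mul1n.
  by congr (tnth m _ * tnth m _ * _)%N; apply/val_inj.
have invE (m : 3.-tuple nat) : inv_sum R m
    = (tnth m ord0)%:R^-1 + (tnth m i1)%:R^-1 + (tnth m ord_max)%:R^-1.
  rewrite /inv_sum !big_ord_recr /= big_ord0 add0r.
  by congr ((tnth m _)%:R^-1 + (tnth m _)%:R^-1 + _); apply/val_inj.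
have [||| lim_le lim_ge] := @lim_multi_infty R 3
    (fun m => ln #|box_covers b m|%:R / (prod_norm m)%:R) E.
- by move=> m; rewrite divr_ge0 ?ln_beta_ge0.
- move=> m m0; have /andP[+ _] := ln_box_covers_bounds R b (sidesE m) m0.
  apply: le_trans.
  have := ln_stack_covers_ge R b (sides m) (m0 ord_max).
  rewrite /E volE; have := m0 ord0; have := m0 i1; have := m0 ord_max.
  move: (ln_beta R b _) (ln _) => x z.
  move: (tnth m ord0) (tnth m i1) (tnth m ord_max) => a c d d0 c0 a0 le.
  rewrite -subr_ge0 [X in 0 <= X](_ : _
    = (z - (2 * d)%:R * x) / (2 ^ 3 * (a * c * d))%:R).
    by rewrite divr_ge0 ?subr_ge0.
  by field; rewrite ?pnatr_eq0; lia.
- move=> m' m'0; exists (ln 2 + 2 * ln (2 * 3).+1%:R) => m m0.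
  have /andP[_] := ln_box_covers_bounds R b (sidesE m) m0.
  move=> /le_trans; apply; rewrite (mulrDl (ln 2)) addrA lerD2r.
  have a0 : (0 < 2 * tnth m ord0)%N by rewrite muln_gt0 m0.
  have c0 : (0 < 2 * tnth m i1)%N by rewrite muln_gt0 m0.
  have d0 : (0 < 2 * tnth m ord_max)%N by rewrite muln_gt0 m0.
  have a'0 : (0 < 2 * tnth m' ord0)%N by rewrite muln_gt0 m'0.
  have := ln_stack_covers_le R b (sides m) d0.
  (* The sides of [m] are exchanged for those of [m'] one at a time, through the mixed pair (2 m'_1,
     2 m_2). *)
  have := ln_beta2_lel R b a0 c0 (m'0 ord0).
  have := ln_beta2_ler R b a'0 c0 (m'0 i1).
  rewrite /E volE prod_norm2 invE.
  have := m0 ord0; have := m0 i1; have := m0 ord_max.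
  move: (ln_beta R b [tuple (2 * tnth m' ord0)%N; (2 * tnth m i1)%N] / _)
    (ln_beta R b (sides m') / _) (ln_beta R b (sides m)) (ln #|_|%:R).
  move=> w y x z; move: {a0 c0 d0} (tnth m ord0) (tnth m i1) (tnth m ord_max).
  move=> a c d d0 c0 a0 le_wy le_xw le_z.
  have {}le_z : z / (2 ^ 3 * (a * c * d))%:R
      <= ln 2 / (2 * d)%:R + x / (2 * a * (2 * c))%:R.
    rewrite -subr_ge0 [X in 0 <= X](_ : _
      = ((2 * a * (2 * c))%:R * ln 2 + (2 * d)%:R * x - z)
        / (2 ^ 3 * (a * c * d))%:R).
      by rewrite divr_ge0 ?subr_ge0.
    by field; rewrite ?pnatr_eq0; lia.
  have := ln2_half_le R a; have := ln2_half_le R c.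
  by have := ln2_half_le R d; lra.
split.
  have := lim_le [tuple r; t; 1%N].
  rewrite /E /ln_beta2 !muln_eq0 (gtn_eqF r0) (gtn_eqF t0) /=.
  rewrite (_ : 2 * r * (2 * t) = 4 * r * t)%N; last by lia.
  apply=> k; case: (unliftP ord0 k) => [j ->|->] //.
  by case: (unliftP ord0 j) => [l ->|->] //; rewrite ord1.
(* [c0] collects the errors of shortening the first side and of passing to [2 * v], [c1] that of
   shortening the second side, both after division by [u * p]. *)
pose c0 : R := (2 * q)%:R * ln 2 / p%:R.
pose c1 : R := ((p + 2 * q) * (2 * s))%:R * ln 2 / (u * p)%:R.
apply: (lim_ge _ (c0 + c1)) => m m0.
have a0 : (0 < 2 * tnth m ord0)%N by rewrite muln_gt0 m0.
have n0 : (0 < 2 * tnth m i1)%N by rewrite muln_gt0 m0.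
have pq0 : (0 < p + 2 * q)%N by rewrite ltn_addr.
have le1 := ln_beta2_ger R b s pq0 u0 (m0 i1).
have le2 := ln_beta2_gel R b q p0 (m0 ord0) n0.
have le3 := ln_beta2_even_le R b q v0 n0.
have XE : ln_beta2 R b (p + 2 * q) (2 * tnth m i1)
    = ln_beta R b [tuple (p + 2 * q)%N; (2 * tnth m i1)%N].
  by rewrite /ln_beta2 (gtn_eqF pq0) (gtn_eqF n0).
rewrite XE in le2.
move: le1 le2 le3; rewrite /E invE.
move: (ln2_half_le R (tnth m ord0)) (ln2_half_le R (tnth m i1)).
move: (m0 ord0) (m0 i1).
move: (ln_beta R b [tuple (p + 2 * q)%N; _] / _) (ln_beta R b (sides m) / _).
move=> x e.
move: (ln_beta2 R b (2 * q) _ / (2 * tnth m i1)%:R) => y.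
move: (ln_beta2 R b _ (u + 2 * s)) (ln_beta2 R b _ (2 * s)) => A D.
move: (ln_beta2 R b (2 * q) (2 * v)) => z.
rewrite {XE n0 a0 sidesE volE invE lim_le lim_ge}.
have : 0 <= (tnth m ord_max)%:R^-1 :> R by rewrite invr_ge0.
move: (tnth m ord_max)%:R^-1 => w.
move: (tnth m ord0) (tnth m i1) => a c w0 a0 n0 half_a half_c le1 le2 le3.
have {le2 le3} lex : x <= p%:R * e + z / (2 * v)%:R
    + (2 * q)%:R * (ln 2 / c%:R) + (2 * q)%:R * (ln 2 / a%:R).
  have := ler_wpM2l (ler0n R (2 * q)) half_a.
  by have := ler_wpM2l (ler0n R (2 * q)) half_c; lra.
have le_AD : A - D <= u%:R * (p%:R * e + z / (2 * v)%:R
    + (2 * q)%:R * (ln 2 / c%:R) + (2 * q)%:R * (ln 2 / a%:R))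
    + ((p + 2 * q) * (2 * s))%:R * (ln 2 / c%:R).
  apply: le_trans le1 _; rewrite -mulrA; apply: lerD.
    exact: ler_wpM2l.
  exact: ler_wpM2l.
have up0 : 0 < (u * p)%:R :> R by rewrite ltr0n muln_gt0 u0.
(* The exact error is reached first; the remaining terms of [(c0 + c1) * inv_sum R m] are
   nonnegative. *)
apply: (@le_trans _ _ (e + c0 * (a%:R^-1 + c%:R^-1) + c1 * c%:R^-1)).
  rewrite lerBlDr ler_pdivrMr //; apply: (le_trans le_AD).
  rewrite le_eqVlt; apply/orP; left; apply/eqP; rewrite /c0 /c1.
  by field; rewrite ?pnatr_eq0; lia.
have c00 : 0 <= c0 by rewrite divr_ge0 ?mulr_ge0.
have c10 : 0 <= c1 by rewrite divr_ge0 ?mulr_ge0.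
have := mulr_ge0 c00 w0; have := mulr_ge0 c10 w0.
have : 0 <= c1 * a%:R^-1 by rewrite mulr_ge0 ?invr_ge0.
lra.
Qed.

Theorem theorem6p6 (R : realType) (p r t u v q s : nat)
    (hp : (0 < p)%N) (hr : (0 < r)%N) (ht : (0 < t)%N)
    (hu : (0 < u)%N) (hv : (0 < v)%N) :
  (ln (beta1 R (2 * r)) / (2 * r)%:R >= h R 2 /\
   h R 2 >= (ln (beta1 R (p + 2 * q)) - ln (beta1 R (2 * q))) / p%:R) /\
  (ln (beta1_tilde R (2 * r)) / (2 * r)%:R >= h_tilde R 2 /\
   h_tilde R 2 >=
     (ln (beta1_tilde R (p + 2 * q)) - ln (beta1_tilde R (2 * q))) / p%:R) /\
  (ln (beta2 R (2 * r) (2 * t)) / (4 * r * t)%:R >= h R 3 /\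
   h R 3 >=
     (ln (beta2 R (p + 2 * q) (u + 2 * s)) - ln (beta2 R (p + 2 * q) (2 * s)))
       / (u * p)%:R
     - ln (beta2 R (2 * q) (2 * v)) / (2 * v * p)%:R) /\
  (ln (beta2_tilde R (2 * r) (2 * t)) / (4 * r * t)%:R >= h_tilde R 3 /\
   h_tilde R 3 >=
     (ln (beta2_tilde R (p + 2 * q) (u + 2 * s))
        - ln (beta2_tilde R (p + 2 * q) (2 * s))) / (u * p)%:R
     - ln (beta2_tilde R (2 * q) (2 * v)) / (2 * v * p)%:R).
Proof.
have ln2X k : ln (2 ^+ k) = k%:R * ln 2 :> R by rewrite lnXn // mulr_natl.
have lnb1 a : ln (beta1 R a) = ln_beta1 R true a.
  by rewrite /beta1 /ln_beta1 -ln_betaE; case: eqP.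
have lnb1t a : ln (beta1_tilde R a) = ln_beta1 R false a.
  by rewrite /beta1_tilde /ln_beta1 -ln_betaE; case: eqP.
have lnb2 a c : ln (beta2 R a c) = ln_beta2 R true a c.
  rewrite /beta2 /ln_beta2 -ln_betaE.
  by case: eqP => _; [|case: eqP => _]; rewrite ?ln2X.
have lnb2t a c : ln (beta2_tilde R a c) = ln_beta2 R false a c.
  rewrite /beta2_tilde /ln_beta2 -ln_betaE.
  by case: eqP => _; [|case: eqP => _]; rewrite ?ln2X.
split; first by rewrite !lnb1 h_box_entropy; apply: entropy2_bounds.
split; first by rewrite !lnb1t h_tilde_box_entropy; apply: entropy2_bounds.
by split; [rewrite !lnb2 h_box_entropy|rewrite !lnb2t h_tilde_box_entropy];
  apply: entropy3_bounds.
Qed.
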